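(* Let $\mathcal{H}$ be generated by a polynomial decay kernel of order $m$, i.e. $\mu_i\asymp i^{-2m}$. Let $\lambda^*=n^{-\frac{4m}{4m+1}}$ and $s^*=s_{\lambda^*}\asymp n^{\frac{2}{4m+1}}$. Suppose that Assumption A2 holds with $\lambda\asymp\lambda^*$, $c_1,c_2\in(0,\infty]$ and $m>3/2$. Then for any $\varepsilon>0$ there exist constants $C_\varepsilon$ and $N_\varepsilon$ such that, with probability greater than $1-e^{-c_mn^{(2m-3)/(2m-1)}}-e^{-c_1s}-e^{-c_2s^*}$, $$\inf_{n\ge N_\varepsilon}\ \inf_{\substack{f\in\mathcal{B}\\ \|f\|_n\ge C_\varepsilon n^{-\frac{2m}{4m+1}}}}P_f(\phi_{n,\lambda}=1\mid\boldsymbol{x},S)\ge1-\varepsilon,$$ where $c_m$ is a constant depending on $m$ only, $\mathcal{B}=\{f\in\mathcal{H}:\|f\|_{\mathcal{H}}\le C\}$ for a constant $C$, and $P_f(\cdot\mid\boldsymbol{x},S)$ is the conditional probability measure under $f$ given $\boldsymbol{x}=(x_1,\dots,x_n)$ and $S$.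
   Context: Model: $y_i=f(x_i)+\epsilon_i$, $i=1,\dots,n$, where $x_1,\dots,x_n$ are i.i.d. from a distribution $P_X$ on $\mathcal{X}\subseteq\mathbb{R}^d$ ($d\ge1$ fixed), $\epsilon_i$ are i.i.d. $N(0,1)$ and independent of $(x_1,\dots,x_n)$ and $S$, and $f\in\mathcal{H}$. Kernel: $\mathcal{H}\subset L^2(P_X)$ is an RKHS with inner product $\langle\cdot,\cdot\rangle_{\mathcal{H}}$ and reproducing kernel $K(x,x')=\sum_{i=1}^\infty\mu_i\phi_i(x)\phi_i(x')$, with ordered eigenvalues $\mu_1\ge\mu_2\ge\cdots\ge0$, where $\{\phi_i\}$ is a basis of $L^2(P_X)$ with $\langle\phi_i,\phi_j\rangle_{L^2(P_X)}=\delta_{ij}$ and $\langle\phi_i,\phi_j\rangle_{\mathcal{H}}=\delta_{ij}/\mu_i$. Assumption A1 (standing): $\sup_{i\ge1}\|\phi_i\|_{\sup}<\infty$ and $\sup_{k\ge1}\frac{\sum_{i=k+1}^\infty\mu_i}{k\mu_k}<\infty$. Estimator and test of $H_0:f=0$ versus $H_1:f\in\mathcal{H}\setminus\{0\}$: $\boldsymbol{K}=[n^{-1}K(x_i,x_j)]_{1\le i,j\le n}$, $\boldsymbol{y}=(y_1,\dots,y_n)^\top$; for an $s\times n$ real random matrix $S$, $\widehat\beta=\frac1n(S\boldsymbol{K}^2S^\top+\lambda S\boldsymbol{K}S^\top)^{-1}S\boldsymbol{K}\boldsymbol{y}$, $\widehat f_R(\cdot)=\sum_{i=1}^n(S^\top\widehat\beta)_iK(\cdot,x_i)$,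 $T_{n,\lambda}=\|\widehat f_R\|_n^2$ with $\|g\|_n^2=\frac1n\sum_{i=1}^ng(x_i)^2$. With $\Delta=\boldsymbol{K}S^\top(S\boldsymbol{K}^2S^\top+\lambda S\boldsymbol{K}S^\top)^{-1}S\boldsymbol{K}$, set $\mu_{n,\lambda}=\mathrm{tr}(\Delta^2)/n$ and $\sigma_{n,\lambda}^2=2\,\mathrm{tr}(\Delta^4)/n^2$ with $\sigma_{n,\lambda}\ge0$. The test at significance level $\alpha$ is $\phi_{n,\lambda}=I(|T_{n,\lambda}-\mu_{n,\lambda}|\ge z_{1-\alpha/2}\sigma_{n,\lambda})$, $z_{1-\alpha/2}$ being the $100(1-\alpha/2)$th percentile of $N(0,1)$. Let $\boldsymbol{K}=UDU^\top$, $UU^\top=I_n$, $D=\mathrm{diag}(\widehat\mu_1,\dots,\widehat\mu_n)$, $\widehat\mu_1\ge\cdots\ge\widehat\mu_n\ge0$. Let $\widehat s_\lambda=\min\{i:\widehat\mu_i\le\lambda\}-1$ and $s_\lambda=\min\{i:\mu_i\le\lambda\}-1$. Write $U=(U_1,U_2)$ with $U_1$ the first $\widehat s_\lambda$ columns, and $D_2=\mathrm{diag}(\widehat\mu_{\widehat s_\lambda+1},\dots,\widehat\mu_n)$. $S$ is $\boldsymbol{K}$-satisfiable if there is a constant $c>0$ with $\|(SU_1)^\top SU_1-I_{\widehat s_\lambda}\|_{\mathrm{op}}\le1/2$ and $\|SU_2D_2^{1/2}\|_{\mathrm{op}}\le c\lambda^{1/2}$. An event $\mathcal{E}$ is of $(a,b)$-type,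 $a,b\in(0,\infty]$, if $P(P(\mathcal{E}\mid x_1,\dots,x_n)\ge1-e^{-a})\ge1-e^{-b}$. Assumption A2: (a) $s\ge ds_\lambda$ for a sufficiently large constant $d>0$; (b) there exist $c_1,c_2\in(0,\infty]$ such that the event ''$S$ is $\boldsymbol{K}$-satisfiable'' is of $(c_1s,c_2s_\lambda)$-type.
   Formalization: The term e^{-c_2 s^*} is replaced by e^{-c_2 min(s_λ, s^* )}, since the literal bound can fail when s_λ < s^*; and the probability bound is stated separately for each n ≥ N_ε rather than for one event covering all such n. *)

(* Defs.v *)
From HB Require Import structures.
From mathcomp Require Import all_boot all_order all_algebra.
From mathcomp Require Import all_classical all_reals all_analysis.

Set Implicit Arguments.
Unset Strict Implicit.
Unset Printing Implicit Defensive.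

Import Order.TTheory GRing.Theory Num.Theory.
Import numFieldNormedType.Exports.

Local Open Scope classical_set_scope.
Local Open Scope ring_scope.

Section Probability.
Local Open Scope ereal_scope.
Context (R : realType) (dO : measure_display) (Omega : measurableType dO).
Variable P : probability Omega R.

Definition mutually_independent (dT : measure_display) (T : measurableType dT)
    (Y : nat -> Omega -> T) : Prop :=
  forall (J : seq nat) (B : nat -> set T),
    uniq J -> (forall i, measurable (B i)) ->
    P (\bigcap_(i in [set` J]) (Y i @^-1` B i))
      = \big[*%E/1%E]_(i <- J) P (Y i @^-1` B i).

Definition independent_algebras (F G : set (set Omega)) : Prop :=
  forall A B, F A -> G B -> P (A `&` B) = P A * P B.

Definition entry_events (s n : nat) (S : Omega -> 'M[R]_(s, n)) :
    set (set Omega) :=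
  [set A | exists i j B,
     measurable B /\ A = (fun w => S w i j) @^-1` B].

(* [g \o X] is a version of the conditional probability of [E] given [X]. *)
Definition is_cond_prob (dT : measure_display) (T : measurableType dT)
    (X : Omega -> T) (E : set Omega) (g : T -> R) : Prop :=
  measurable_fun setT g /\
  forall B, measurable B ->
    P (E `&` X @^-1` B) = \int[P]_(w in X @^-1` B) (g (X w))%:E.

(* [a = +oo] is allowed: [expeR -oo = 0]. *)
Definition ab_type (dT : measure_display) (T : measurableType dT)
    (X : Omega -> T) (E : set Omega) (a b : \bar R) : Prop :=
  measurable E /\
  exists g : T -> R, is_cond_prob X E g /\
    1 - expeR (- b) <= P [set w | 1 - expeR (- a) <= (g (X w))%:E].

End Probability.

Definition normal_quantile (R : realType) (p : R) : R :=
  inf [set z : R | (p%:E <= normal_prob 0 1 `]-oo, z])%E].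

Section Kernel.
Context (R : realType) (d : nat).
Notation E := (d.-tuple R).

(* Functions on the domain [X] are represented by functions on R^d; two of them
   are identified when they agree on [X], which is why definiteness and the
   reproducing property only look at points of [X]. *)
Record rkhs (X : set E) (H : set (E -> R)) (ip : (E -> R) -> (E -> R) -> R)
    (K : E -> E -> R) : Prop := {
  rkhs_zero : H (fun=> 0);
  rkhs_lin : forall a f g, H f -> H g -> H (a \*o f \+ g);
  rkhs_ipC : forall f g, H f -> H g -> ip f g = ip g f;
  rkhs_ip_lin : forall a f g h, H f -> H g -> H h ->
    ip (a \*o f \+ g) h = a * ip f h + ip g h;
  rkhs_ip_ge0 : forall f, H f -> 0 <= ip f f;
  rkhs_ip_eq0 : forall f, H f -> (ip f f = 0 <-> forall x, X x -> f x = 0);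
  rkhs_complete : forall u : nat -> E -> R,
    (forall k, H (u k)) ->
    (forall e, 0 < e -> exists N, forall i j, (N <= i)%N -> (N <= j)%N ->
       ip (u i \- u j) (u i \- u j) < e) ->
    exists2 f, H f & (fun k => ip (u k \- f) (u k \- f)) @ \oo --> (0 : R);
  rkhs_kernel : forall x, X x -> H (K x);
  rkhs_reproducing : forall f x, H f -> X x -> ip f (K x) = f x }.

(* Eigenpairs are numbered from 0: [mu i] and [phi i] are $\mu_{i+1}$ and
   $\phi_{i+1}$. *)
Record eigen_system (X : set E) (PX : probability E R) (H : set (E -> R))
    (ip : (E -> R) -> (E -> R) -> R) (K : E -> E -> R)
    (mu : nat -> R) (phi : nat -> E -> R) : Prop := {
  eigen_ge0 : forall i, 0 <= mu i;
  eigen_noninc : nonincreasing_seq mu;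
  eigen_L2 : forall i, phi i \in Lfun PX 2%:E;
  eigen_orthonormal : forall i j,
    (\int[PX]_t (phi i t * phi j t)%:E = (i == j)%:R%:E)%E;
  eigen_basis : forall g : E -> R, g \in Lfun PX 2%:E ->
    (fun N : nat => Lnorm PX 2%:E (EFin \o (g \- (fun t =>
       \sum_(i < N) Rintegral PX setT (fun u => g u * phi i u) * phi i t))))
      @ \oo --> 0%E;
  eigen_in_H : forall i, 0 < mu i -> H (phi i);
  eigen_orth_H : forall i j, 0 < mu i -> 0 < mu j ->
    ip (phi i) (phi j) = (i == j)%:R / mu i;
  eigen_expansion : forall x x', X x -> X x' ->
    series (fun i => mu i * phi i x * phi i x') @ \oo --> K x x' }.

Definition assumption_A1 (X : set E) (mu : nat -> R) (phi : nat -> E -> R) :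
    Prop :=
  (exists M : R, forall i x, X x -> `|phi i x| <= M) /\
  (exists M : R, forall k : nat,
     (\sum_(k.+1 <= i <oo) (mu i)%:E <= (M * (k.+1%:R * mu k))%:E)%E).

End Kernel.

(* min {i >= 1 : mu_i <= lam} - 1, i.e. the least 0-based such index. *)
Definition s_lambda (R : realType) (mu : nat -> R) (lam : R) : nat :=
  xget 0%N [set i | mu i <= lam /\ forall j, (j < i)%N -> lam < mu j].

Section Satisfiable.
Context (R : realType).

Definition l2norm (n : nat) (v : 'cV[R]_n) : R :=
  Num.sqrt (\sum_i v i 0 ^+ 2).

Definition op_norm (p q : nat) (A : 'M[R]_(p, q)) : R :=
  sup [set l2norm (A *m v) | v in [set v : 'cV[R]_q | l2norm v <= 1]].

Definition eigen_decomposition (n : nat) (Km U : 'M[R]_n) (D : 'rV[R]_n) :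
    Prop :=
  [/\ U *m U^T = 1%:M,
      Km = U *m diag_mx D *m U^T,
      forall i j : 'I_n, (i <= j)%N -> D 0 j <= D 0 i &
      forall i, 0 <= D 0 i].

(* As for [s_lambda], with value [n] when all eigenvalues exceed [lam]. *)
Definition s_hat (n : nat) (D : 'rV[R]_n) (lam : R) : nat :=
  find (fun j => D 0 j <= lam) (enum 'I_n).

Lemma s_hat_le (n : nat) (D : 'rV[R]_n) (lam : R) : (s_hat D lam <= n)%N.
Proof. by rewrite -[leqRHS]size_enum_ord find_size. Qed.

Definition split_cols (p n k : nat) (hk : (k <= n)%N) (A : 'M[R]_(p, n)) :
    'M[R]_(p, k + (n - k)) :=
  castmx (erefl p, esym (subnKC hk)) A.

Definition satisfiable (c lam : R) (s n : nat) (Km : 'M[R]_n)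
    (S : 'M[R]_(s, n)) : Prop :=
  exists (U : 'M[R]_n) (D : 'rV[R]_n),
    let hk := s_hat_le D lam in
    let U1 := lsubmx (split_cols hk U) in
    let U2 := rsubmx (split_cols hk U) in
    let D2sqrt := diag_mx (map_mx Num.sqrt (rsubmx (split_cols hk D))) in
    [/\ eigen_decomposition Km U D,
        op_norm ((S *m U1)^T *m (S *m U1) - 1%:M) <= 1 / 2 &
        op_norm (S *m U2 *m D2sqrt) <= c * Num.sqrt lam].

End Satisfiable.

Section Test.
Context (R : realType) (d n s : nat).
Notation E := (d.-tuple R).
Variables (K : E -> E -> R) (lam : R).

Definition emp_norm (x : n.-tuple E) (g : E -> R) : R :=
  Num.sqrt (n%:R^-1 * \sum_(i < n) g (tnth x i) ^+ 2).

Definition gram (x : n.-tuple E) : 'M[R]_n :=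
  \matrix_(i, j) (n%:R^-1 * K (tnth x i) (tnth x j)).

(* [S K^2 S^T + lam S K S^T] can be singular (for instance if S has repeated
   rows).  [pinvmx] is the inverse when there is one ([pinvmxE]), and otherwise a
   generalized inverse, for which [f_hat] on the sample, [Delta] and hence the
   test do not depend on the choice made. *)
Definition ridge_inv (Km : 'M[R]_n) (S : 'M[R]_(s, n)) : 'M[R]_s :=
  pinvmx (S *m Km ^+ 2 *m S^T + lam *: (S *m Km *m S^T)).

Definition beta_hat (x : n.-tuple E) (S : 'M[R]_(s, n)) (y : 'cV[R]_n) :
    'cV[R]_s :=
  n%:R^-1 *: (ridge_inv (gram x) S *m S *m gram x *m y).

Definition f_hat (x : n.-tuple E) (S : 'M[R]_(s, n)) (y : 'cV[R]_n) (t : E) :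
    R :=
  \sum_(i < n) (S^T *m beta_hat x S y) i 0 * K t (tnth x i).

Definition T_stat (x : n.-tuple E) (S : 'M[R]_(s, n)) (y : 'cV[R]_n) : R :=
  emp_norm x (f_hat x S y) ^+ 2.

Definition Delta (x : n.-tuple E) (S : 'M[R]_(s, n)) : 'M[R]_n :=
  gram x *m S^T *m ridge_inv (gram x) S *m S *m gram x.

Definition mu_stat (x : n.-tuple E) (S : 'M[R]_(s, n)) : R :=
  \tr (Delta x S ^+ 2) / n%:R.

Definition sigma_stat (x : n.-tuple E) (S : 'M[R]_(s, n)) : R :=
  Num.sqrt (2 * \tr (Delta x S ^+ 4) / n%:R ^+ 2).

Definition rejects (alpha : R) (x : n.-tuple E) (S : 'M[R]_(s, n))
    (y : 'cV[R]_n) : bool :=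
  normal_quantile (1 - alpha / 2) * sigma_stat x S
    <= `|T_stat x S y - mu_stat x S|.

End Test.

Section Model.
Context (R : realType) (d : nat) (dO : measure_display)
  (Omega : measurableType dO).
Notation E := (d.-tuple R).
Variables (P : probability Omega R) (x : nat -> Omega -> E)
  (eps : nat -> Omega -> R).

Definition sample (n : nat) (w : Omega) : n.-tuple E :=
  [tuple x i w | i < n].

Definition iid_design (X : set E) (PX : probability E R) : Prop :=
  [/\ forall i, measurable_fun setT (x i),
      forall i w, X (x i w),
      forall i B, measurable B -> P (x i @^-1` B) = PX B &
      mutually_independent P x].

Definition iid_std_normal : Prop :=
  [/\ forall i, measurable_fun setT (eps i),
      forall i B, measurable B -> P (eps i @^-1` B) = normal_prob 0 1 B &
      mutually_independent P eps].

Definition random_sketch (s n : nat) (S : Omega -> 'M[R]_(s, n)) : Prop :=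
  forall i j, measurable_fun setT (fun w => S w i j).

(* The noise is independent of the pair (design, sketch). *)
Definition noise_independent (s n : nat) (S : Omega -> 'M[R]_(s, n)) : Prop :=
  independent_algebras P
    (g_sigma_preimage (fun i : 'I_n => eps i))
    <<s g_sigma_preimage (fun i : 'I_n => x i) `|` entry_events S >>.

(* P_f(phi_{n,lam} = 1 | x, S) at the outcome [w].  Since the noise is independent
   of (x, S), the regular conditional law of y given (x, S) is the law of
   f(x_i) + eps_i with x and S frozen.  A pointwise version is needed because an
   infimum over an uncountable class of f is taken. *)
Definition cond_power (K : E -> E -> R) (lam alpha : R) (s n : nat)
    (S : Omega -> 'M[R]_(s, n)) (f : E -> R) (w : Omega) : \bar R :=
  P [set w' | rejects K lam alpha (sample n w) (S w)
                (\col_(i < n) (f (x i w) + eps i w'))].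

Definition assumption_A2 (K : E -> E -> R) (mu : nat -> R) (lam : nat -> R)
    (s : nat -> nat) (S : forall n : nat, Omega -> 'M[R]_(s n, n))
    (dconst : R) (c1 c2 : \bar R) : Prop :=
  (forall n : nat, (0 < n)%N ->
     dconst * (s_lambda mu (lam n))%:R <= (s n)%:R) /\
  exists2 c : R, 0 < c & forall n : nat, (0 < n)%N ->
    ab_type P (sample n)
      [set w | satisfiable c (lam n) (gram K (sample n w)) (S n w)]
      (c1 * (s n)%:R%:E)%E (c2 * (s_lambda mu (lam n))%:R%:E)%E.

End Model.

(* {f in B : ||f||_n >= r} for the ball B of radius [C] of H. *)
Definition separated_ball (R : realType) (d n : nat)
    (H : set (d.-tuple R -> R))
    (ip : (d.-tuple R -> R) -> (d.-tuple R -> R) -> R) (C r : R)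
    (x : n.-tuple (d.-tuple R)) : set (d.-tuple R -> R) :=
  [set f | [/\ H f, Num.sqrt (ip f f) <= C & r <= emp_norm x f]].

Definition lambda_star (R : realType) (m : R) (n : nat) : R :=
  n%:R `^ (- (4 * m / (4 * m + 1))).

(* Main.v *)
Require Import Defs.
From mathcomp Require Import all_boot all_order all_algebra.
From mathcomp Require Import all_classical all_reals all_analysis.
From mathcomp Require Import measurable_realfun zify ring lra.
Set Implicit Arguments.
Unset Strict Implicit.
Unset Printing Implicit Defensive.
Import Order.TTheory GRing.Theory Num.Theory.
Import numFieldNormedType.Exports.
Local Open Scope classical_set_scope.
Local Open Scope ring_scope.

(** Let [D] be the sketched ridge smoother, so that the fitted values are [D y]
    and the statistic is [|D y|^2 / n].  With [y = f + eps], the statistic minus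
    its null mean is [a + L + Q], where [a = |D f|^2 / n], [L] is linear in the
    noise and [Q] is the centred quadratic form of [D^2 / n].  The test rejects
    with probability close to one as soon as [a] dominates the critical value and
    the standard deviations of [L] and [Q].

    Size of the noise.  The variance of [Q] and the square of the critical value
    are of the order of [tr (D^4) / n^2].  For every sketch,
    [D^2 <= D <= K (K + lam)^-1] in the Loewner order
    ([ridge_smoother_contract], [ridge_smoother_le_resolvent]), hence
    [tr (D^4) <= tr D <= tr (K (K + lam)^-1)].  Write the Gram matrix as the
    Mercer sum of rank-one terms [b_j b_j^T]: the [j]-th term contributes
    [b_j^T (K + lam)^-1 b_j <= min (1, |b_j|^2 / lam)] to the last trace, and
    [|b_j|^2 <= M^2 mu_j] because the eigenfunctions are uniformly bounded.  So the
    trace is [O(n^(2 / (4 m + 1)))] for every design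
    ([effective_dimension_le], [tail_asymptotics]), and the critical value is of
    the order of [lambda_star].

    Size of the signal.  [D f] minimises a sketched ridge criterion, and when [S]
    is satisfiable the criterion is at most a multiple of [n lam] at a sketched
    vector that interpolates the leading coordinates of [f]
    ([ridge_smoother_residual], [satisfiable_approx]).  Hence
    [a >= |f|_n^2 / 2 - B lam], which is a large multiple of [lambda_star] on the
    separated class.

    Chebyshev's inequality for [L] and [Q] ([noise_form_tail]) then gives the
    power bound at every outcome where [S] is satisfiable, for all [f] at once;
    the event asked for is satisfiability, and its type bounds its probability
    ([ab_type_prob]).

    The second moments of [L] and [Q] rest on two ingredients: expectations of
    products of functions of distinct noise variables factor
    ([integral_prod_indep]), and the first two Gaussian moments, which are read
    off the total masses of the shifted and rescaled Gaussian densities by means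
    of [1 + u <= exp u]. *)

(** * Symmetric positive semidefinite matrices *)

Lemma discriminant_le (R : realFieldType) (a b c : R) :
  (forall t, 0 <= a + 2 * t * b + t ^+ 2 * c) -> b ^+ 2 <= a * c.
Proof.
move=> h.
have [c0|c0] := eqVneq c 0.
  have [->|b0] := eqVneq b 0; first by rewrite c0 expr0n mulr0.
  have := h (- (a + 1) / (2 * b)); rewrite c0 mulr0 addr0.
  have -> : 2 * (- (a + 1) / (2 * b)) * b = - (a + 1) by field.
  lra.
have := h (- b / c).
have -> : a + 2 * (- b / c) * b + (- b / c) ^+ 2 * c = a - b ^+ 2 / c by field.
rewrite subr_ge0.
have c_gt0 : 0 < c.
  rewrite lt_neqAle eq_sym c0 /= leNgt; apply/negP => cn.
  (* For negative [c] a large [t] makes the trinomial negative. *)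
  pose t := 1 + (`|a| + 2 * `|b|) / - c.
  have cp : 0 < - c by lra.
  have tge1 : 1 <= t.
    by rewrite lerDl divr_ge0 ?(ltW cp)// addr_ge0// mulr_ge0.
  have := h t.
  suff : a + 2 * t * b + t ^+ 2 * c < 0 by move=> /lt_geF ->.
  have tc : t * c = c - (`|a| + 2 * `|b|).
    by rewrite /t; field; rewrite ?oppr_eq0 c0.
  have -> : t ^+ 2 * c = t * (t * c) by ring.
  rewrite tc.
  have := ler_norm a; have := ler_norm b => hb ha.
  have ht : `|a| <= t * `|a| by rewrite ler_peMl.
  have hb2 : t * b <= t * `|b| by rewrite ler_wpM2l//; lra.
  have : t * c < 0 by rewrite pmulr_rlt0//; lra.
  nra.
by rewrite ler_pdivrMr.
Qed.

Section Dot.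
Variable R : realType.

Definition dot n (u v : 'cV[R]_n) : R := (u^T *m v) 0 0.

Definition psd n (A : 'M[R]_n) : Prop := forall v, 0 <= dot v (A *m v).

Lemma dotE n (u v : 'cV[R]_n) : dot u v = \sum_i u i 0 * v i 0.
Proof. by rewrite /dot mxE; apply: eq_bigr => i _; rewrite mxE. Qed.

Lemma dotC n (u v : 'cV[R]_n) : dot u v = dot v u.
Proof. by rewrite !dotE; apply: eq_bigr => i _; rewrite mulrC. Qed.

Lemma dotDl n (u v w : 'cV[R]_n) : dot (u + v) w = dot u w + dot v w.
Proof. by rewrite /dot linearD mulmxDl mxE. Qed.

Lemma dotDr n (u v w : 'cV[R]_n) : dot w (u + v) = dot w u + dot w v.
Proof. by rewrite /dot mulmxDr mxE. Qed.

Lemma dotZl n a (u w : 'cV[R]_n) : dot (a *: u) w = a * dot u w.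
Proof. by rewrite /dot linearZ -scalemxAl mxE. Qed.

Lemma dotZr n a (u w : 'cV[R]_n) : dot w (a *: u) = a * dot w u.
Proof. by rewrite dotC dotZl dotC. Qed.

Lemma dotNl n (u w : 'cV[R]_n) : dot (- u) w = - dot u w.
Proof. by rewrite -scaleN1r dotZl mulN1r. Qed.

Lemma dotNr n (u w : 'cV[R]_n) : dot w (- u) = - dot w u.
Proof. by rewrite dotC dotNl dotC. Qed.

Lemma dotBl n (u v w : 'cV[R]_n) : dot (u - v) w = dot u w - dot v w.
Proof. by rewrite dotDl dotNl. Qed.

Lemma dotBr n (u v w : 'cV[R]_n) : dot w (u - v) = dot w u - dot w v.
Proof. by rewrite dotDr dotNr. Qed.

Lemma dot0l n (w : 'cV[R]_n) : dot 0 w = 0.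
Proof. by rewrite -(scale0r 0) dotZl mul0r. Qed.

Lemma dot0r n (w : 'cV[R]_n) : dot w 0 = 0.
Proof. by rewrite dotC dot0l. Qed.

Definition dotD := (dotDl, dotDr, dotBl, dotBr, dotNl, dotNr, dotZl, dotZr).

Lemma dot_adj m n (A : 'M[R]_(m, n)) u v : dot (A *m u) v = dot u (A^T *m v).
Proof. by rewrite /dot trmx_mul mulmxA. Qed.

Lemma dotvv_ge0 n (v : 'cV[R]_n) : 0 <= dot v v.
Proof. by rewrite dotE; apply: sumr_ge0 => i _; rewrite -expr2 sqr_ge0. Qed.

Lemma dotvv_eq0 n (v : 'cV[R]_n) : dot v v = 0 -> v = 0.
Proof.
rewrite dotE => /eqP; rewrite psumr_eq0; last by move=> i _; rewrite -expr2 sqr_ge0.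
move=> /allP h; apply/matrixP => i j; rewrite (ord1 j) mxE.
by have := h i (mem_index_enum _); rewrite -expr2 sqrf_eq0 => /eqP.
Qed.

Lemma psd_cauchy n (A : 'M[R]_n) : A^T = A -> psd A -> forall u v,
  dot u (A *m v) ^+ 2 <= dot u (A *m u) * dot v (A *m v).
Proof.
move=> symA psdA u v; apply: discriminant_le => t.
have := psdA (u + t *: v).
rewrite mulmxDr -scalemxAr !dotD.
have -> : dot v (A *m u) = dot u (A *m v) by rewrite dotC dot_adj symA.
by congr (_ <= _); ring.
Qed.

Lemma psd1 n : psd (1%:M : 'M[R]_n).
Proof. by move=> v; rewrite mul1mx dotvv_ge0. Qed.

Lemma cauchy n (u v : 'cV[R]_n) : dot u v ^+ 2 <= dot u u * dot v v.
Proof.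
have := psd_cauchy (trmx1 _ _) (@psd1 n) u v; by rewrite !mul1mx.
Qed.

Lemma dotvvD n (u v : 'cV[R]_n) :
  dot (u + v) (u + v) <= 2 * dot u u + 2 * dot v v.
Proof.
have := dotvv_ge0 (u - v); rewrite !dotD (dotC v u); lra.
Qed.

Lemma dot_delta n (A : 'M[R]_n) i :
  dot (delta_mx i 0) (A *m delta_mx i 0) = A i i.
Proof.
by rewrite /dot trmx_delta -colE -rowE !mxE.
Qed.

Lemma mxtrace_dot n (A : 'M[R]_n) :
  \tr A = \sum_i dot (delta_mx i 0) (A *m delta_mx i 0).
Proof. by apply: eq_bigr => i _; rewrite dot_delta. Qed.

Lemma mxtrace_le n (A B : 'M[R]_n) :
  (forall v, dot v (A *m v) <= dot v (B *m v)) -> \tr A <= \tr B.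
Proof. by move=> h; rewrite !mxtrace_dot; apply: ler_sum. Qed.

End Dot.

(** * The sketched ridge smoother *)

Section Ridge.
Variables (R : realType) (n s : nat) (K : 'M[R]_n) (S : 'M[R]_(s, n)) (lam : R).
Hypotheses (symK : K^T = K) (psdK : psd K) (lam_gt0 : 0 < lam).

Let M : 'M[R]_s := S *m K ^+ 2 *m S^T + lam *: (S *m K *m S^T).
Let Z : 'M[R]_(n, s) := K *m S^T *m pinvmx M.

Definition ridge_smoother : 'M[R]_n := K *m S^T *m pinvmx M *m S *m K.
Let D := ridge_smoother.

Let ridge_sym : M^T = M.
Proof.
by rewrite /M expr2 -mulmxE linearD linearZ /= !trmx_mul !trmxK symK !mulmxA.
Qed.

Let ridge_form (b : 'cV[R]_s) : dot b (M *m b) =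
  dot (K *m S^T *m b) (K *m S^T *m b) + lam * dot (S^T *m b) (K *m (S^T *m b)).
Proof.
rewrite /M expr2 -mulmxE mulmxDl dotDr -scalemxAl dotZr; congr (_ + _ * _).
  by rewrite [RHS]dot_adj trmx_mul trmxK symK !mulmxA.
by rewrite [RHS]dot_adj trmxK !mulmxA.
Qed.

(* [M] may be singular, but its kernel is killed by [K S^T], so the generalised
   inverse acts as an inverse where it matters. *)
Let ZM : Z *m M = K *m S^T.
Proof.
apply: mulmxKpV; rewrite submxE; apply/eqP/matrixP => i j; rewrite [RHS]mxE.
pose b : 'cV[R]_s := cokermx M *m delta_mx j 0.
suff h : K *m S^T *m b = 0.
  have <- : col j (K *m S^T *m cokermx M) i 0 = (K *m S^T *m cokermx M) i j.
    by rewrite mxE.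
  by rewrite colE -mulmxA h mxE.
have Mb : M *m b = 0 by rewrite /b mulmxA mulmx_coker mul0mx.
apply: dotvv_eq0; have := ridge_form b; rewrite Mb /dot mulmx0 mxE -!/(dot _ _).
move=> h0; have h1 := dotvv_ge0 (K *m S^T *m b); have h2 := psdK (S^T *m b).
have h3 : 0 <= lam * dot (S^T *m b) (K *m (S^T *m b)) by rewrite mulr_ge0// ltW.
apply/eqP; rewrite eq_le h1 andbT; lra.
Qed.

Let MZ : M *m Z^T = S *m K.
Proof. by rewrite -[LHS]trmxK (trmx_mul M) trmxK ridge_sym ZM trmx_mul trmxK symK. Qed.

Let DE : D = Z *m M *m Z^T.
Proof. by rewrite -mulmxA MZ /Z /D /ridge_smoother -!mulmxA. Qed.

Lemma ridge_smoother_sym : D^T = D.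
Proof.
by rewrite DE (trmx_mul (Z *m M)) (trmx_mul Z M) trmxK ridge_sym mulmxA.
Qed.

Let dotD_M (v : 'cV[R]_n) : dot v (D *m v) = dot (Z^T *m v) (M *m (Z^T *m v)).
Proof. by rewrite dot_adj trmxK DE -!mulmxA. Qed.

Let D_KSZ (v : 'cV[R]_n) : D *m v = K *m S^T *m (Z^T *m v).
Proof. by rewrite DE ZM -mulmxA. Qed.

(** [D = Z M Z^T] and [D^2 = Z (S K^2 S^T) Z^T], where [S K^2 S^T] is the unpenalised
    part of [M]. *)
Lemma ridge_smoother_contract (v : 'cV[R]_n) : dot (D *m v) (D *m v) <= dot v (D *m v).
Proof.
by rewrite dotD_M ridge_form -D_KSZ lerDl mulr_ge0// ltW.
Qed.

Lemma ridge_smoother_norm (v : 'cV[R]_n) : dot (D *m v) (D *m v) <= dot v v.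
Proof.
have := ridge_smoother_contract v; have := dotvv_ge0 (v - D *m v).
rewrite !dotD (dotC (D *m v) v); lra.
Qed.

(** [D *m f] is the minimiser of the sketched ridge criterion, with quadratic
    part [M]; hence the residual is controlled by the criterion at any [b]. *)
Lemma ridge_smoother_residual (f : 'cV[R]_n) (b : 'cV[R]_s) :
  dot (f - D *m f) (f - D *m f)
    <= dot (f - K *m S^T *m b) (f - K *m S^T *m b)
       + lam * dot (S^T *m b) (K *m (S^T *m b)).
Proof.
set b0 := Z^T *m f.
have Db : D *m f = K *m S^T *m b0 by rewrite D_KSZ.
have Mb0 : M *m b0 = S *m K *m f by rewrite mulmxA MZ.
have crit c : dot (f - K *m S^T *m c) (f - K *m S^T *m c)
    + lam * dot (S^T *m c) (K *m (S^T *m c))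
    = dot f f - 2 * dot c (M *m b0) + dot c (M *m c).
  rewrite (ridge_form c) Mb0 !dotD.
  have -> : dot f (K *m S^T *m c) = dot c (S *m K *m f).
    by rewrite dotC dot_adj trmx_mul trmxK symK.
  rewrite (dotC _ f).
  have -> : dot f (K *m S^T *m c) = dot c (S *m K *m f).
    by rewrite dotC dot_adj trmx_mul trmxK symK.
  ring.
rewrite crit Db.
have := crit b0.
have p0 : 0 <= lam * dot (S^T *m b0) (K *m (S^T *m b0)) by rewrite mulr_ge0// ltW.
have psdM : 0 <= dot (b - b0) (M *m (b - b0)).
  by rewrite ridge_form addr_ge0 ?dotvv_ge0// mulr_ge0// ltW.
move: psdM; rewrite mulmxBr !dotD.
have -> : dot b0 (M *m b) = dot b (M *m b0) by rewrite dotC dot_adj ridge_sym.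
lra.
Qed.

Let N : 'M[R]_n := K + lam%:M.

Let N_form (v : 'cV[R]_n) : dot v (N *m v) = dot v (K *m v) + lam * dot v v.
Proof. by rewrite mulmxDl mul_scalar_mx dotDr dotZr. Qed.

Lemma ridge_unit : K + lam%:M \in unitmx.
Proof.
rewrite -row_free_unit -kermx_eq0; apply/eqP/row_matrixP => i; rewrite row0.
set u := row i _.
have uN : u *m N = 0 by rewrite -row_mul mulmx_ker row0.
suff : u^T = 0 by move=> h; rewrite -[u]trmxK h trmx0.
apply: dotvv_eq0.
have := N_form u^T.
have -> : N *m u^T = (u *m N)^T by rewrite trmx_mul linearD /= tr_scalar_mx symK.
rewrite uN trmx0 /dot mulmx0 [X in X = _]mxE -!/(dot _ _).
have h1 := psdK u^T; have h2 := dotvv_ge0 u^T => h.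
apply/eqP; rewrite eq_le h2 andbT.
have : lam * dot u^T u^T <= 0 by lra.
by rewrite pmulr_rle0.
Qed.

Let NK (v : 'cV[R]_n) : N *m (invmx N *m v) = v.
Proof. by rewrite mulmxA mulmxV ?mul1mx// ridge_unit. Qed.

Let symN : N^T = N. Proof. by rewrite linearD /= tr_scalar_mx symK. Qed.

Let commKN : K *m invmx N = invmx N *m K.
Proof.
have h : K *m N = N *m K by rewrite mulmxDr mulmxDl scalar_mxC.
rewrite -[LHS]mul1mx -(mulVmx ridge_unit) -!mulmxA (mulmxA N) -h -(mulmxA K).
by rewrite mulmxV ?ridge_unit// mulmx1.
Qed.

(** Cauchy-Schwarz for the form [Q = K (K + lam)]: with [u = S^T Z^T v], both
    [u^T Q u] and [u^T K v = u^T Q (K + lam)^-1 v] equal [v^T D v]. *)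
Lemma ridge_smoother_le_resolvent (v : 'cV[R]_n) :
  dot v (D *m v) <= dot v (invmx (K + lam%:M) *m K *m v).
Proof.
rewrite -/N -commKN.
set x := dot v (D *m v).
set Q := K *m N.
have QE u : dot u (Q *m u) = dot (K *m u) (K *m u) + lam * dot u (K *m u).
  rewrite /Q mulmxDr mulmxDl dotDr [in RHS]dot_adj symK mulmxA mul_mx_scalar.
  by rewrite -scalemxAl dotZr.
have symQ : Q^T = Q by rewrite /Q trmx_mul symN symK mulmxDr mulmxDl scalar_mxC.
have psdQ : psd Q by move=> u; rewrite QE addr_ge0 ?dotvv_ge0// mulr_ge0// ltW.
have := psd_cauchy symQ psdQ (S^T *m (Z^T *m v)) (invmx N *m v).
have -> : Q *m (invmx N *m v) = K *m v by rewrite /Q -mulmxA NK.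
have -> : dot (S^T *m (Z^T *m v)) (K *m v) = x.
  by rewrite dot_adj trmxK mulmxA -MZ -mulmxA -dotD_M.
have -> : dot (S^T *m (Z^T *m v)) (Q *m (S^T *m (Z^T *m v))) = x.
  by rewrite QE /x dotD_M ridge_form !mulmxA.
have -> : dot (invmx N *m v) (K *m v) = dot v (K *m invmx N *m v).
  by rewrite dot_adj trmx_inv symN commKN mulmxA.
have x0 : 0 <= x by apply: le_trans (ridge_smoother_contract v); exact: dotvv_ge0.
rewrite expr2.
have [->|xn0] := eqVneq x 0.
  move=> _; have := psdQ (invmx N *m v).
  rewrite /Q -mulmxA NK dot_adj trmx_inv symN commKN mulmxA //.
by rewrite ler_pM2l// lt_neqAle eq_sym xn0.
Qed.

(** With [v = (K + lam)^-1 b], the hypothesis at [v] reads [t^2 <= t] for the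
    leverage [t = b^T v = v^T (K + lam) v]. *)
Lemma ridge_leverage_le1 (b : 'cV[R]_n) :
  (forall v, dot b v ^+ 2 <= dot v (K *m v)) ->
  dot b (invmx (K + lam%:M) *m b) <= 1.
Proof.
move=> h; set v := invmx _ *m b.
have bv : dot b v = dot v (N *m v) by rewrite NK dotC.
have := h v; have := dotvv_ge0 v; have := N_form v; rewrite -bv => e1 h1 h2.
have h3 : dot b v ^+ 2 <= dot b v by have := mulr_ge0 (ltW lam_gt0) h1; lra.
have h4 := psdK v; rewrite leNgt; apply/negP => h5; move: h3; rewrite expr2; nra.
Qed.

Lemma ridge_leverage_le (b : 'cV[R]_n) :
  dot b (invmx (K + lam%:M) *m b) <= dot b b / lam.
Proof.
set v := invmx _ *m b.
have bv : dot b v = dot v (N *m v) by rewrite NK dotC.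
have h1 := cauchy b v; have h2 := N_form v; have h3 := dotvv_ge0 v.
have h4 := psdK v; have h5 := dotvv_ge0 b.
rewrite ler_pdivlMr//.
have h6 : lam * dot v v <= dot b v by lra.
have [->|v0] := eqVneq (dot b v) 0; first by rewrite mul0r.
have vp : 0 < dot b v.
  by have := mulr_ge0 (ltW lam_gt0) h3; rewrite lt_neqAle eq_sym v0 /=; lra.
have : dot b v * (dot b v * lam) <= dot b v * dot b b.
  have : lam * dot b v ^+ 2 <= lam * (dot b b * dot v v) by rewrite ler_wpM2l// ltW.
  have : dot b b * (lam * dot v v) <= dot b b * dot b v by rewrite ler_wpM2l.
  rewrite expr2; lra.
by rewrite ler_pM2l.
Qed.

Lemma tr_ridge_smoother4 : \tr (D ^+ 4) <= \tr D.
Proof.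
apply: mxtrace_le => v.
have -> : D ^+ 4 = D ^+ 2 *m D ^+ 2 by rewrite mulmxE -exprD.
have symD2 : (D ^+ 2)^T = D ^+ 2.
  by rewrite expr2 -mulmxE trmx_mul ridge_smoother_sym.
rewrite -mulmxA -{1}symD2 -dot_adj.
have e2 : D ^+ 2 *m v = D *m (D *m v) by rewrite expr2 -mulmxE mulmxA.
rewrite e2; apply: le_trans (ridge_smoother_norm _) _.
exact: ridge_smoother_contract.
Qed.

Lemma tr_ridge_smoother_le : \tr D <= \tr (invmx (K + lam%:M) *m K).
Proof. by apply: mxtrace_le => v; exact: ridge_smoother_le_resolvent. Qed.

End Ridge.

(** * Consequences of satisfiability *)

Section OpNorm.
Variable R : realType.

Lemma l2norm_sqr n (v : 'cV[R]_n) : l2norm v ^+ 2 = dot v v.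
Proof.
rewrite /l2norm dotE sqr_sqrtr; last by apply: sumr_ge0 => i _; exact: sqr_ge0.
by apply: eq_bigr => i _; rewrite expr2.
Qed.

Lemma l2norm_ge0 n (v : 'cV[R]_n) : 0 <= l2norm v.
Proof. exact: sqrtr_ge0. Qed.

Lemma l2normZ n a (v : 'cV[R]_n) : 0 <= a -> l2norm (a *: v) = a * l2norm v.
Proof.
move=> a0; apply/eqP; rewrite -(eqrXn2 (n := 2))// ?mulr_ge0 ?l2norm_ge0//.
by rewrite exprMn !l2norm_sqr dotZl dotZr expr2 mulrA.
Qed.

Lemma mulmx_bounded p q (A : 'M[R]_(p, q)) :
  exists F, forall v, dot (A *m v) (A *m v) <= F * dot v v.
Proof.
exists (\sum_i dot (row i A)^T (row i A)^T) => v.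
rewrite [leLHS]dotE mulr_suml; apply: ler_sum => i _.
have -> : (A *m v) i 0 = dot (row i A)^T v.
  by rewrite /dot trmxK -row_mul [RHS]mxE.
by rewrite -expr2 cauchy.
Qed.

Lemma op_norm_le p q (A : 'M[R]_(p, q)) v :
  l2norm (A *m v) <= op_norm A * l2norm v.
Proof.
set E := [set l2norm (A *m v) | v in [set v : 'cV[R]_q | l2norm v <= 1]].
have ubE : has_ubound E.
  have [F hF] := mulmx_bounded A; exists (Num.max F 1) => _ [w /= w1 <-].
  have F1 : 1 <= Num.max F 1 by rewrite le_max lexx orbT.
  have w0 := l2norm_ge0 w.
  rewrite -(@ler_pXn2r _ 2)// ?nnegrE ?l2norm_ge0//; last lra.
  rewrite l2norm_sqr; apply: le_trans (hF w) _.
  apply: (@le_trans _ _ (Num.max F 1)); last by rewrite expr2 ler_peMl//; lra.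
  have ww : dot w w <= 1 by rewrite -l2norm_sqr expr_le1.
  apply: (@le_trans _ _ (Num.max F 1 * dot w w)).
    by rewrite ler_wpM2r ?dotvv_ge0// le_max lexx.
  by rewrite ler_piMr//; lra.
have [v0|v0] := eqVneq (l2norm v) 0.
  have -> : v = 0 by apply: dotvv_eq0; rewrite -l2norm_sqr v0 expr0n.
  have e0 r : l2norm (0 : 'cV[R]_r) = 0.
    apply/eqP; rewrite -sqrf_eq0 l2norm_sqr /dot mulmx0 mxE //.
  by rewrite mulmx0 !e0 mulr0.
have vp : 0 < l2norm v by rewrite lt_neqAle eq_sym v0 l2norm_ge0.
rewrite -ler_pdivrMr// mulrC -l2normZ ?invr_ge0 ?l2norm_ge0// scalemxAr.
apply: ub_le_sup => //; exists ((l2norm v)^-1 *: v) => //=.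
by rewrite l2normZ ?invr_ge0 ?l2norm_ge0// mulVf.
Qed.

Lemma op_norm_le_dot p q (A : 'M[R]_(p, q)) c v : op_norm A <= c ->
  dot (A *m v) (A *m v) <= c ^+ 2 * dot v v.
Proof.
move=> Ac; rewrite -!l2norm_sqr -exprMn.
have h : l2norm (A *m v) <= c * l2norm v.
  by apply: le_trans (op_norm_le A v) _; rewrite ler_wpM2r// l2norm_ge0.
by rewrite lerXn2r// ?nnegrE ?l2norm_ge0//; apply: le_trans h; exact: l2norm_ge0.
Qed.

Lemma op_norm_le_tr_dot p q (A : 'M[R]_(p, q)) c u : op_norm A <= c ->
  dot (A^T *m u) (A^T *m u) <= c ^+ 2 * dot u u.
Proof.
move=> Ac; set y := dot _ _.
have yE : y = dot u (A *m (A^T *m u)) by rewrite /y dot_adj trmxK.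
have h1 := cauchy u (A *m (A^T *m u)); rewrite -yE in h1.
have h2 := op_norm_le_dot (A^T *m u) Ac; rewrite -/y in h2.
have y0 : 0 <= y by exact: dotvv_ge0.
have [->|yn0] := eqVneq y 0; first by rewrite mulr_ge0 ?sqr_ge0 ?dotvv_ge0.
have yp : 0 < y by rewrite lt_neqAle eq_sym yn0.
rewrite -(ler_pM2l yp) -expr2; apply: le_trans h1 _.
apply: le_trans (ler_wpM2l (dotvv_ge0 u) h2) _.
by rewrite le_eqVlt; apply/orP; left; apply/eqP; ring.
Qed.

End OpNorm.

Section SplitCols.
Variables (R : realType) (n k : nat) (hk : (k <= n)%N).

Lemma split_colsE p (A : 'M[R]_(p, n)) i j :
  split_cols hk A i j = A i (cast_ord (subnKC hk) j).
Proof. by rewrite /split_cols castmxE /= cast_ord_id esymK. Qed.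

Lemma mul_split_cols p q (A : 'M[R]_(p, n)) (B : 'M[R]_(n, q)) :
  A *m B = lsubmx (split_cols hk A) *m (lsubmx (split_cols hk B^T))^T
    + rsubmx (split_cols hk A) *m (rsubmx (split_cols hk B^T))^T.
Proof.
apply/matrixP => i j; rewrite !mxE.
rewrite (reindex (cast_ord (subnKC hk))) /=; last first.
  by exists (cast_ord (esym (subnKC hk))) => x _; rewrite ?cast_ordK ?cast_ordKV.
rewrite big_split_ord /=; congr (_ + _); apply: eq_bigr => l _.
  by rewrite !mxE !split_colsE mxE.
by rewrite !mxE !split_colsE mxE.
Qed.

Lemma split_cols_diag p (A : 'M[R]_(p, n)) (d : 'rV[R]_n) :
  lsubmx (split_cols hk (A *m diag_mx d))
    = lsubmx (split_cols hk A) *m diag_mx (lsubmx (split_cols hk d)) /\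
  rsubmx (split_cols hk (A *m diag_mx d))
    = rsubmx (split_cols hk A) *m diag_mx (rsubmx (split_cols hk d)).
Proof.
by split; apply/matrixP => i j; rewrite !mul_mx_diag !mxE !split_colsE !mxE.
Qed.

Lemma split_cols_orthonormal p (A : 'M[R]_(p, n)) : A^T *m A = 1%:M ->
  let A1 := lsubmx (split_cols hk A) in let A2 := rsubmx (split_cols hk A) in
  [/\ A1^T *m A1 = 1%:M, A2^T *m A2 = 1%:M & A1^T *m A2 = 0].
Proof.
move=> AA A1 A2.
have h i j : \sum_l A l i * A l j = (i == j)%:R.
  have := congr1 (fun M : 'M[R]_n => M i j) AA; rewrite !mxE => <-.
  by apply: eq_bigr => l _; rewrite !mxE.
split; apply/matrixP => i j; rewrite !mxE.
- under eq_bigr do rewrite !mxE !split_colsE.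
  by rewrite h (inj_eq (@cast_ord_inj _ _ _)) (inj_eq (@lshift_inj _ _)).
- under eq_bigr do rewrite !mxE !split_colsE.
  by rewrite h (inj_eq (@cast_ord_inj _ _ _)) (inj_eq (@rshift_inj _ _)).
- under eq_bigr do rewrite !mxE !split_colsE.
  by rewrite h (inj_eq (@cast_ord_inj _ _ _)) eq_lrshift.
Qed.

End SplitCols.

Lemma s_hat_gt (R : realType) n (D : 'rV[R]_n) lam (j : 'I_(s_hat D lam)) :
  lam < lsubmx (split_cols (s_hat_le D lam) D) 0 j.
Proof.
rewrite mxE split_colsE.
set i := cast_ord _ _.
have := @before_find _ i (fun j => D 0 j <= lam) (enum 'I_n) j (ltn_ord j).
rewrite (_ : nth _ _ _ = i); last first.
  by apply: ord_inj; rewrite nth_enum_ord //= (leq_trans (ltn_ord j))// s_hat_le.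
by rewrite leNgt => /negbFE.
Qed.

Lemma s_hat_le_lam (R : realType) n (D : 'rV[R]_n) lam
    (j : 'I_(n - s_hat D lam)) :
  (forall i j : 'I_n, (i <= j)%N -> D 0 j <= D 0 i) ->
  rsubmx (split_cols (s_hat_le D lam) D) 0 j <= lam.
Proof.
move=> Dni; rewrite mxE split_colsE.
set i := cast_ord _ _.
have sn : (s_hat D lam < n)%N.
  by have := ltn_ord j; rewrite ltn_subRL; apply: leq_ltn_trans; rewrite leq_addr.
have hh : has (fun j => D 0 j <= lam) (enum 'I_n) by rewrite has_find size_enum_ord.
apply: le_trans (Dni (Ordinal sn) i _) _; first by rewrite /= leq_addr.
have := nth_find i hh; rewrite (_ : nth _ _ _ = Ordinal sn)//.
by apply: ord_inj; rewrite nth_enum_ord.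
Qed.

Lemma dot_diag_mx (R : realType) n (d : 'rV[R]_n) (u v : 'cV[R]_n) :
  dot u (diag_mx d *m v) = \sum_i d 0 i * (u i 0 * v i 0).
Proof.
by rewrite dotE; apply: eq_bigr => i _; rewrite mul_diag_mx mxE mulrCA.
Qed.

Lemma satisfiable_sym_psd (R : realType) (n s : nat) (K : 'M[R]_n)
    (S : 'M[R]_(s, n)) c lam : satisfiable c lam K S -> K^T = K /\ psd K.
Proof.
move=> [U [D [[UU -> _ D0] _ _]]]; split.
  by rewrite !trmx_mul tr_diag_mx trmxK mulmxA.
move=> v; rewrite -!mulmxA -[U in dot _ (U *m _)]trmxK -dot_adj dot_diag_mx.
by apply: sumr_ge0 => i _; rewrite mulr_ge0// -expr2 sqr_ge0.
Qed.

(** If [W] is a near isometry, the equation [W^T b = t] has a solution of the order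
    of [t]: take [b = W (W^T W)^-1 t]. *)
Lemma near_isometry_inverse (R : realType) p k (W : 'M[R]_(p, k)) t :
  op_norm (W^T *m W - 1%:M) <= 1 / 2 ->
  exists b : 'cV[R]_p, W^T *m b = t /\ dot b b <= 3 * dot t t.
Proof.
move=> h; set G := W^T *m W.
have near1 b : dot (G *m b - b) (G *m b - b) <= dot b b / 4.
  have := op_norm_le_dot b h; rewrite mulmxBl mul1mx -/G => h1.
  by apply: le_trans h1 _; rewrite mulrC expr2; lra.
have symG : G^T = G by rewrite /G trmx_mul trmxK.
have uG : G \in unitmx.
  rewrite -row_free_unit -kermx_eq0; apply/eqP/row_matrixP => i; rewrite row0.
  set u := row i _.
  have uG : G *m u^T = 0.
    have : u *m G = 0 by rewrite -row_mul mulmx_ker row0.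
    by move/(congr1 trmx); rewrite trmx_mul symG trmx0.
  suff : u^T = 0 by move=> e; rewrite -[u]trmxK e trmx0.
  apply: dotvv_eq0; have := near1 u^T; rewrite uG sub0r dotNl dotNr opprK.
  have := dotvv_ge0 u^T; lra.
exists (W *m (invmx G *m t)); set b := invmx G *m t.
have Gb : G *m b = t by rewrite mulmxA mulmxV// mul1mx.
split; first by rewrite mulmxA.
have -> : dot (W *m b) (W *m b) = dot b t by rewrite dot_adj mulmxA Gb.
have h1 := near1 b; rewrite Gb !dotD in h1.
have h2 := cauchy b t; rewrite (dotC t b) in h1.
have h3 := dotvv_ge0 b; have h4 := dotvv_ge0 t.
rewrite leNgt; apply/negP => h5.
have h6 : dot b b * dot t t <= (8 / 3 * dot b t) * dot t t.
  by rewrite ler_wpM2r//; lra.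
have : dot b t * dot b t <= dot b t * (8 / 3 * dot t t).
  rewrite -expr2; lra.
rewrite ler_pM2l; lra.
Qed.

(** The hypothesis on [f] says that [f] lies in the image of a ball under
    [K^(1/2)].  The vector [b] is chosen so that [K S^T b] agrees with [f] on the
    eigenvectors above [lam]; this is possible because the sketch is a near isometry
    there.  Below [lam] the vector [f] is itself small, and so is [K S^T b] by the
    second satisfiability condition. *)
Lemma satisfiable_approx (R : realType) (n s : nat) (K : 'M[R]_n)
    (S : 'M[R]_(s, n)) (c lam B : R) (f : 'cV[R]_n) :
  0 < lam -> 0 <= B -> satisfiable c lam K S ->
  (forall a, dot a f ^+ 2 <= B * dot a (K *m a)) ->
  exists b : 'cV[R]_s,
    dot (f - K *m S^T *m b) (f - K *m S^T *m b)
      + lam * dot (S^T *m b) (K *m (S^T *m b)) <= (3 + 9 * c ^+ 2) * B * lam.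
Proof.
move=> lam0 B0 [U [D []]]; have lam_ge0 := ltW lam0.
set hk := s_hat_le D lam; set U1 := lsubmx _; set U2 := rsubmx _.
set D1 := lsubmx (split_cols hk D); set D2 := rsubmx (split_cols hk D).
move=> [UU KE Dni D0] hS1 hS2 fB.
have UU' : U^T *m U = 1%:M by apply/mulmx1C.
have [U11 U22 U12] := split_cols_orthonormal hk UU'; rewrite -/U1 -/U2 in U11 U22 U12.
have U21 : U2^T *m U1 = 0 by rewrite -[LHS]trmxK trmx_mul trmxK U12 trmx0.
have D1lam j : lam < D1 0 j by exact: s_hat_gt.
have D2lam j : D2 0 j <= lam by exact: s_hat_le_lam.
have D2ge0 j : 0 <= D2 0 j by rewrite mxE split_colsE.
have U1U2 : 1%:M = U1 *m U1^T + U2 *m U2^T.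
  by rewrite -UU (mul_split_cols hk) trmxK.
have K12 : K = U1 *m diag_mx D1 *m U1^T + U2 *m diag_mx D2 *m U2^T.
  rewrite KE (mul_split_cols hk) trmxK.
  by have [-> ->] := split_cols_diag hk U D.
set g1 := U1^T *m f; set g2 := U2^T *m f.
pose t : 'cV[R]_(s_hat D lam) := \col_j (g1 j 0 / D1 0 j).
have D1t : diag_mx D1 *m t = g1.
  apply/matrixP => i j; rewrite (ord1 j) mul_diag_mx !mxE mulrC divfK//.
  by have := D1lam i; rewrite mxE => /(lt_trans lam0)/gt_eqF ->.
have orth (a1 : 'cV[R]_(s_hat D lam)) (a2 : 'cV[R]_(n - s_hat D lam)) :
    dot (U1 *m a1 + U2 *m a2) (U1 *m a1 + U2 *m a2) = dot a1 a1 + dot a2 a2.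
  rewrite dotDl !dotDr !dot_adj !mulmxA U11 U22 U12 U21 !mul1mx !mul0mx.
  by rewrite !dot0r addr0 add0r.
have Kform a : dot a (K *m a) = dot (U1^T *m a) (diag_mx D1 *m (U1^T *m a))
    + dot (U2^T *m a) (diag_mx D2 *m (U2^T *m a)).
  by rewrite K12 mulmxDl dotDr ![dot (_^T *m a) _]dot_adj !trmxK !mulmxA.
(* [t] holds the coordinates of [K^-1 f] above [lam], and [X] is the part of the
   squared native norm of [f] that they carry. *)
set X := dot t (diag_mx D1 *m t).
have tX : lam * dot t t <= X.
  rewrite /X dot_diag_mx dotE mulr_sumr; apply: ler_sum => i _.
  by apply: ler_wpM2r; [rewrite -expr2 sqr_ge0 | exact: ltW].
have X0 : 0 <= X by apply: le_trans tX; rewrite mulr_ge0// dotvv_ge0.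
have XB : X <= B.
  have := fB (U1 *m t).
  have -> : dot (U1 *m t) f = X by rewrite dot_adj -/g1 -D1t.
  rewrite Kform !(mulmxA _ U1) U11 U21 mul1mx mul0mx dot0l addr0 -/X expr2.
  have [X0'|Xn0] := eqVneq X 0; first by rewrite X0'.
  by rewrite ler_pM2r// lt_neqAle eq_sym Xn0.
have g2B : dot g2 g2 <= B * lam.
  have := fB (U2 *m g2).
  rewrite dot_adj -/g2 Kform !(mulmxA _ U2) U12 U22 mul1mx mul0mx dot0l add0r.
  move=> h.
  have g2l : dot g2 (diag_mx D2 *m g2) <= lam * dot g2 g2.
    rewrite dot_diag_mx dotE mulr_sumr; apply: ler_sum => i _.
    by rewrite ler_wpM2r// -expr2 sqr_ge0.
  have h2 := le_trans h (ler_wpM2l B0 g2l).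
  have [->|gn0] := eqVneq (dot g2 g2) 0; first by rewrite mulr_ge0.
  by move: h2; rewrite expr2 mulrA ler_pM2r// lt_neqAle eq_sym gn0 dotvv_ge0.
have [b [Wb bt]] := near_isometry_inverse t hS1.
exists b.
have S1b : U1^T *m (S^T *m b) = t by rewrite -Wb trmx_mul mulmxA.
set w := U2^T *m (S^T *m b).
set Y := dot w (diag_mx D2 *m w).
have YE : Y = dot ((S *m U2 *m diag_mx (map_mx Num.sqrt D2))^T *m b)
                  ((S *m U2 *m diag_mx (map_mx Num.sqrt D2))^T *m b).
  rewrite !trmx_mul tr_diag_mx -!mulmxA -/w dot_adj tr_diag_mx mulmxA.
  rewrite mulmx_diag /Y; congr (dot _ (diag_mx _ *m _)).
  by apply/matrixP => i j; rewrite (ord1 i) !mxE -expr2 sqr_sqrtr ?split_colsE.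
have Y3 : Y <= 3 * c ^+ 2 * B.
  rewrite YE; apply: le_trans (op_norm_le_tr_dot b hS2) _.
  rewrite exprMn sqr_sqrtr//.
  have h : lam * dot b b <= 3 * B.
    by have := ler_wpM2l (ltW lam0) bt; lra.
  have := ler_wpM2l (sqr_ge0 c) h; lra.
have D2w : dot (diag_mx D2 *m w) (diag_mx D2 *m w) <= lam * Y.
  rewrite dotE /Y dot_diag_mx mulr_sumr; apply: ler_sum => i _.
  rewrite mul_diag_mx mxE.
  have -> : D2 0 i * w i 0 * (D2 0 i * w i 0) =
      D2 0 i * (D2 0 i * (w i 0 * w i 0)) by ring.
  by rewrite ler_wpM2r// mulr_ge0// -expr2 sqr_ge0.
have -> : f - K *m S^T *m b =
    U1 *m (g1 - diag_mx D1 *m t) + U2 *m (g2 - diag_mx D2 *m w).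
  rewrite -[f in LHS]mul1mx U1U2 K12 -(mulmxA _ S^T b) !mulmxDl !mulmxBr.
  by rewrite -!mulmxA S1b -/w -/g1 -/g2 opprD addrACA.
rewrite orth D1t subrr Kform S1b -/w -/Y -/X.
rewrite dot0r.
have h := dotvvD g2 (- (diag_mx D2 *m w)).
rewrite dotNl dotNr opprK in h.
have h3 := ler_wpM2l (ltW lam0) XB; have h4 := ler_wpM2l (ltW lam0) Y3.
lra.
Qed.

(** * Sampled functions and the Mercer expansion *)

Section Sample.
Context (R : realType) (d : nat) (X : set (d.-tuple R))
  (H : set (d.-tuple R -> R))
  (ip : (d.-tuple R -> R) -> (d.-tuple R -> R) -> R)
  (K : d.-tuple R -> d.-tuple R -> R).
Hypothesis hH : rkhs X H ip K.

Lemma rkhs_cauchy f g : H f -> H g -> ip f g ^+ 2 <= ip f f * ip g g.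
Proof.
move=> Hf Hg; apply: discriminant_le => t.
have Htg : H (t \*o g \+ f) by exact: (rkhs_lin hH).
have := rkhs_ip_ge0 hH Htg.
rewrite (rkhs_ip_lin hH) // (rkhs_ipC hH Hg Htg) (rkhs_ipC hH Hf Htg).
rewrite !(rkhs_ip_lin hH) // (rkhs_ipC hH Hg Hf).
by congr (_ <= _); ring.
Qed.

Lemma rkhs_comb n (a : 'I_n -> R) (x : 'I_n -> d.-tuple R) :
  (forall i, X (x i)) -> exists g, [/\ H g,
    forall t, g t = \sum_i a i * K (x i) t &
    forall f, H f -> ip f g = \sum_i a i * f (x i)].
Proof.
elim: n a x => [|n ih] a x Xx.
  exists (fun=> 0); split; first exact: rkhs_zero hH.
    by move=> t; rewrite big_ord0.
  move=> f Hf; rewrite big_ord0 (rkhs_ipC hH Hf (rkhs_zero hH)).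
  have e : (-1) \*o (fun=> 0) \+ (fun=> 0) = (fun=> 0 : R) :> (d.-tuple R -> R).
    by apply/funext => t /=; rewrite mulr0 addr0.
  have := rkhs_ip_lin hH (-1) (rkhs_zero hH) (rkhs_zero hH) Hf.
  by rewrite e; lra.
have [g [Hg gE ipg]] := ih (a \o lift ord0) (x \o lift ord0) (fun i => Xx _).
have HK : H (K (x ord0)) := rkhs_kernel hH (Xx ord0).
have Hag : H (a ord0 \*o K (x ord0) \+ g) by exact: (rkhs_lin hH).
exists (a ord0 \*o K (x ord0) \+ g); split => //.
  by move=> t; rewrite big_ord_recl /= gE.
move=> f Hf; rewrite (rkhs_ipC hH Hf Hag) (rkhs_ip_lin hH)//.
rewrite (rkhs_ipC hH HK Hf) (rkhs_reproducing hH Hf (Xx ord0)).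
by rewrite (rkhs_ipC hH Hg Hf) ipg// big_ord_recl.
Qed.

(** [a] paired with the sampled [f] is the inner product of [f] with a combination of
    kernel sections, whose squared norm is [n a^T K a]. *)
Lemma rkhs_sample_le n (x : n.-tuple (d.-tuple R)) f : (0 < n)%N ->
  (forall i, X (tnth x i)) -> H f -> forall a : 'cV[R]_n,
  dot a (\col_i f (tnth x i)) ^+ 2
    <= ip f f * n%:R * dot a (gram K x *m a).
Proof.
move=> n0 Xx Hf a.
have [g [Hg gE ipg]] := rkhs_comb (fun i => a i 0) Xx.
have -> : dot a (\col_i f (tnth x i)) = ip f g.
  by rewrite ipg// dotE; apply: eq_bigr => i _; rewrite mxE.
apply: le_trans (rkhs_cauchy Hf Hg) _.
rewrite -mulrA le_eqVlt; apply/orP; left; apply/eqP; congr (_ * _).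
rewrite ipg// dotE mulr_sumr; apply: eq_bigr => i _.
rewrite gE mxE mulrCA; congr (_ * _).
under [in RHS]eq_bigr do rewrite mxE -mulrA.
rewrite -mulr_sumr mulrA divff ?pnatr_eq0 -?lt0n// mul1r.
apply: eq_bigr => l _; rewrite mulrC; congr (_ * _).
have Hi := rkhs_kernel hH (Xx i); have Hl := rkhs_kernel hH (Xx l).
by rewrite -(rkhs_reproducing hH Hl (Xx i)) (rkhs_ipC hH Hl Hi)
   (rkhs_reproducing hH Hi (Xx l)).
Qed.

End Sample.

Section Mercer.
Context (R : realType) (d : nat) (X : set (d.-tuple R))
  (K : d.-tuple R -> d.-tuple R -> R) (mu : nat -> R)
  (phi : nat -> d.-tuple R -> R).
Hypothesis mu_ge0 : forall i, 0 <= mu i.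
Hypothesis KE : forall x x', X x -> X x' ->
    series (fun i => mu i * phi i x * phi i x') @ \oo --> K x x'.

Context (n : nat) (x : n.-tuple (d.-tuple R)).
Hypotheses (n_gt0 : (0 < n)%N) (Xx : forall i, X (tnth x i)).

(** The [j]-th term of the Mercer expansion of the Gram matrix is the rank-one
    matrix of this vector. *)
Definition mercer_vec j : 'cV[R]_n :=
  \col_i (Num.sqrt (mu j / n%:R) * phi j (tnth x i)).

Lemma mercer_trace (W : 'M[R]_n) :
  (fun N => \sum_(j < N) dot (mercer_vec j) (W *m mercer_vec j)) @ \oo
    --> \tr (W *m gram K x).
Proof.
have -> : (fun N => \sum_(j < N) dot (mercer_vec j) (W *m mercer_vec j)) =
    (fun N => \sum_i \sum_l W i l / n%:R *
      series (fun j => mu j * phi j (tnth x l) * phi j (tnth x i)) N).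
  apply/funext => N; rewrite /series /=.
  under [RHS]eq_bigr do under eq_bigr do rewrite big_mkord mulr_sumr.
  under [RHS]eq_bigr do rewrite exchange_big /=.
  rewrite [RHS]exchange_big /=; apply: eq_bigr => j _.
  rewrite dotE; apply: eq_bigr => i _; rewrite !mxE mulr_sumr.
  apply: eq_bigr => l _; rewrite !mxE.
  have sq : Num.sqrt (mu j / n%:R) * Num.sqrt (mu j / n%:R) = mu j / n%:R.
    by rewrite -expr2 sqr_sqrtr// divr_ge0.
  move: sq; set q := Num.sqrt _ => sq.
  transitivity (W i l * (q * q) * phi j (tnth x l) * phi j (tnth x i)); first ring.
  by rewrite sq !mulrA (mulrAC (W i l)) .
have -> : \tr (W *m gram K x) =
    \sum_i \sum_l W i l / n%:R * K (tnth x l) (tnth x i).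
  apply: eq_bigr => i _; rewrite mxE; apply: eq_bigr => l _.
  by rewrite mxE mulrA.
apply: cvg_big; [exact: add_continuous|move=> i _].
apply: cvg_big; [exact: add_continuous|move=> l _].
apply: cvgMr; exact: KE.
Qed.

(** Every Mercer term lies below the Gram matrix, as the other terms are positive. *)
Lemma mercer_vec_sq_le j v :
  dot (mercer_vec j) v ^+ 2 <= dot v (gram K x *m v).
Proof.
have sq b : dot b (v *m v^T *m b) = dot b v ^+ 2.
  rewrite /dot -mulmxA mulmxA mxE big_ord1 expr2; congr (_ * _).
  exact: dotC.
have -> : dot v (gram K x *m v) = \tr (v *m v^T *m gram K x).
  by rewrite -mulmxA mxtrace_mulC trace_mx11 /dot mulmxA.
refine (@cvgr_to_ge _ _ _ R _ _ _ (@mercer_trace (v *m v^T)) _).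
exists j.+1 => // N /= jN; rewrite (bigD1 (Ordinal jN)) //= sq lerDl.
by apply: sumr_ge0 => i _; rewrite sq sqr_ge0.
Qed.

Lemma mercer_vec_norm M j : (forall y, X y -> `|phi j y| <= M) ->
  dot (mercer_vec j) (mercer_vec j) <= M ^+ 2 * mu j.
Proof.
move=> phiM; rewrite dotE.
apply: (@le_trans _ _ (\sum_(i < n) M ^+ 2 * (mu j / n%:R))).
  apply: ler_sum => i _; rewrite mxE mulrACA -!expr2 sqr_sqrtr ?divr_ge0//.
  rewrite mulrC ler_wpM2r ?divr_ge0// -real_normK ?num_real//.
  have phiMi := phiM _ (Xx i).
  by rewrite lerXn2r// nnegrE//; apply: le_trans phiMi.
by rewrite sumr_const card_ord -[leLHS]mulr_natr -mulrA divfK ?pnatr_eq0 -?lt0n//.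
Qed.

(** The trace is the sum of the leverages of the Mercer vectors.  The first [k] are at
    most [1]; the others are bounded by means of the uniform bound on the
    eigenfunctions, so that no concentration over the design is involved. *)
Lemma effective_dimension_le M lam k T : gram K x = (gram K x)^T ->
  (forall j y, X y -> `|phi j y| <= M) -> 0 < lam ->
  (forall N, \sum_(j < N | (k <= j)%N) mu j <= T) ->
  \tr (invmx (gram K x + lam%:M) *m gram K x) <= k%:R + M ^+ 2 * T / lam.
Proof.
move=> symK phiM lam0 muT.
have psdK : psd (gram K x).
  by move=> v; apply: le_trans (mercer_vec_sq_le 0 v); exact: sqr_ge0.
refine (@cvgr_to_le _ _ _ R _ _ _ (@mercer_trace _) _); apply: nearW => N.
set l := fun j => dot (mercer_vec j) (invmx (gram K x + lam%:M) *m mercer_vec j).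
have l1 j : l j <= 1.
  exact: (ridge_leverage_le1 (esym symK) psdK lam0 (mercer_vec_sq_le j)).
have l2 j : l j <= M ^+ 2 / lam * mu j.
  apply: le_trans (ridge_leverage_le (esym symK) psdK lam0 (mercer_vec j)) _.
  rewrite mulrAC ler_pM2r ?invr_gt0//; apply: mercer_vec_norm => y; exact: phiM.
rewrite (bigID (fun j : 'I_N => (k <= j)%N)) /= addrC; apply: lerD.
  apply: (@le_trans _ _ (\sum_(j < N | ~~ (k <= j)%N) 1)).
    by apply: ler_sum => j _; exact: l1.
  have -> : \sum_(j < N | ~~ (k <= j)%N) 1 = (minn N k)%:R :> R.
    elim: N => [|N ih]; first by rewrite big_ord0 min0n.
    rewrite big_mkcond big_ord_recr -big_mkcond /= ih -ltnNge.
    by case: ltnP => h; rewrite ?addr0 ?natr1; congr (_%:R); lia.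
  by rewrite ler_nat geq_minr.
apply: (@le_trans _ _ (\sum_(j < N | (k <= j)%N) (M ^+ 2 / lam * mu j))).
  by apply: ler_sum => j _; exact: l2.
rewrite -mulr_sumr [leRHS]mulrAC ler_wpM2l//.
by rewrite divr_ge0 ?sqr_ge0// ltW.
Qed.

End Mercer.
(** * Independence and Gaussian moments *)

Import HBNNSimple.

(** If weighting by [h] and pushing forward along [Y] turns [P] into [c Q] on sets,
    it does so on functions.  It serves twice: with [Y] the identity and [h] a
    density, and with [h] independent of [Y], where [c] is the mean of [h]. *)
Lemma ge0_integral_transfer d1 d2 (T1 : measurableType d1)
    (T2 : measurableType d2) (R : realType)
    (P : {measure set T1 -> \bar R}) (Q : {measure set T2 -> \bar R})
    (Y : T1 -> T2) (h : T1 -> R) (c : R) :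
  measurable_fun setT Y -> measurable_fun setT h -> (forall w, 0 <= h w) ->
  0 <= c ->
  (forall B, measurable B ->
     (\int[P]_w (\1_B (Y w) * h w)%:E = c%:E * Q B)%E) ->
  forall g : T2 -> R, measurable_fun setT g -> (forall y, 0 <= g y) ->
  (\int[P]_w (g (Y w) * h w)%:E = c%:E * \int[Q]_y (g y)%:E)%E.
Proof.
move=> mY mh h0 c0 hB g mg g0.
have mEg : measurable_fun setT (fun y => (g y)%:E) by exact/measurable_EFinP.
pose gn := nnsfun_approx measurableT mEg.
have gn_ge0 n y : 0 <= gn n y by [].
have nd_gn y : {homo (fun n => gn n y) : m n / (m <= n)%N >-> m <= n}.
  by move=> m n mn; exact/lefP/nd_nnsfun_approx.
have gn_cvg y : (gn n y)%:E @[n --> \oo] --> (g y)%:E.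
  by apply: cvg_nnsfun_approx => // t _; rewrite /= lee_fin.
have mgn n : measurable_fun setT (gn n) by [].
have step n : (\int[P]_w (gn n (Y w) * h w)%:E = c%:E * \int[Q]_y (gn n y)%:E)%E.
  rewrite (integralT_nnsfun Q (gn n)) sintegralE.
  have fin : finite_set (range (gn n)) by [].
  rewrite fsbig_finite//=.
  pose rs : seq R := finmap.enum_fset (fset_set (range (gn n))).
  have rs_ge0 r : r \in rs -> 0 <= r.
    by rewrite in_fset_set// inE => -[y _ <-].
  have mind r : measurable_fun setT
      (fun w => \1_(gn n @^-1` [set r]) (Y w) * h w).
    apply: measurable_funM => //; apply: measurableT_comp => //.
  rewrite -/rs big_seq ge0_sume_distrr; last first.
    by move=> r /rs_ge0 r0; rewrite mule_ge0.
  rewrite -big_seq.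
  transitivity (\int[P]_w (\sum_(r <- rs)
      (Num.max r 0 * (\1_(gn n @^-1` [set r]) (Y w) * h w))%:E))%E.
    apply: eq_integral => w _.
    rewrite {1}(fimfunE (gn n)) fsbig_finite//= mulr_suml -sumEFin.
    apply: eq_big_seq => r /rs_ge0 r0.
    by rewrite (max_idPl r0) mulrA.
  rewrite ge0_integral_sum//.
  - apply: eq_big_seq => r /rs_ge0 r0.
    rewrite (max_idPl r0); under eq_integral do rewrite EFinM.
    rewrite ge0_integralZl_EFin// ?hB//.
    + by rewrite muleCA.
    + by move=> w _; rewrite lee_fin mulr_ge0.
    + exact/measurable_EFinP.
  - by move=> r; apply/measurable_EFinP; apply: measurable_funM.
  - by move=> r w _; rewrite lee_fin !mulr_ge0// le_max lexx orbT.
have cvg2 : ((c%:E * \int[Q]_y (gn n y)%:E) @[n --> \oo]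
    --> c%:E * \int[Q]_y (g y)%:E)%E.
  apply: cvgeZl => //.
  have -> : (fun y => (g y)%:E) = (fun y => limn (fun n => (gn n y)%:E)).
    by apply/funext => y; apply/esym/cvg_lim => //; exact: gn_cvg.
  apply: cvg_monotone_convergence => //.
  - by move=> n; exact/measurable_EFinP.
  - by move=> n y _; rewrite lee_fin.
  - by move=> y _ m n mn; rewrite lee_fin nd_gn.
rewrite -(funext step) in cvg2.
apply: cvg_unique cvg2 => //.
have -> : (fun w => (g (Y w) * h w)%:E) =
    (fun w => limn (fun n => (gn n (Y w) * h w)%:E)).
  apply/funext => w; apply/esym/cvg_lim => //.
  under eq_fun do rewrite EFinM.
  rewrite EFinM; apply: cvgeZr => //; exact: gn_cvg.
apply: cvg_monotone_convergence => //.
- move=> n; apply/measurable_EFinP; apply: measurable_funM => //.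
  exact: measurableT_comp.
- by move=> n w _; rewrite lee_fin mulr_ge0.
- by move=> w _ m n mn; rewrite lee_fin ler_wpM2r// nd_gn.
Qed.

Section Independence.
Context d (T : measurableType d) (R : realType) (P : probability T R)
  (Q : probability (measurableTypeR R) R) (Y : nat -> T -> R).
Hypothesis mY : forall i, measurable_fun setT (Y i).
Hypothesis lawY : forall i B, measurable B -> P (Y i @^-1` B) = Q B.
Hypothesis indY : mutually_independent P Y.

Let Q_fin (B : set R) : measurable B -> Q B \is a fin_num.
Proof. by move=> mB; apply: (@fin_num_measure _ _ _ Q); exact: mB. Qed.

Definition hits (J : seq nat) (B : nat -> set R) (w : T) : R :=
  \prod_(k <- J) \1_(B k) (Y k w).

(** [h] is independent of the variables with index outside [J], and has mean [a].
    Testing on indicators of the remaining variables is what allows one variable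
    at a time to be moved from the indicators into [h]. *)
Definition ge0_indep_off (J : seq nat) (h : T -> R) (a : R) : Prop :=
  [/\ measurable_fun setT h, forall w, 0 <= h w &
   forall J' B, uniq J' -> (forall k, k \in J' -> k \notin J) ->
     (forall i, measurable (B i)) ->
     (\int[P]_w (hits J' B w * h w)%:E
        = (\prod_(k <- J') fine (Q (B k)) * a)%:E)%E].

Let hits_ge0 J B w : 0 <= hits J B w.
Proof. by apply: prodr_ge0 => k _; rewrite indicE. Qed.

Let measurable_hits J B : (forall i, measurable (B i)) ->
  measurable_fun setT (hits J B).
Proof.
by move=> mB; apply: measurable_prod => k _; apply: measurableT_comp => //.
Qed.

Lemma ge0_indep_off_int J h a : ge0_indep_off J h a -> (\int[P]_w (h w)%:E = a%:E)%E.
Proof.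
move=> [_ _ /(_ [::] (fun=> setT) isT)]; rewrite big_nil mul1r => <- //.
by apply: eq_integral => w _; rewrite /hits big_nil mul1r.
Qed.

Lemma ge0_indep_off_ge0 J h a : ge0_indep_off J h a -> 0 <= a.
Proof.
move=> hf; rewrite -lee_fin -(ge0_indep_off_int hf); case: hf => _ h0 _.
by apply: integral_ge0 => w _; rewrite lee_fin.
Qed.

Lemma ge0_indep_off1 : ge0_indep_off [::] (fun=> 1) 1.
Proof.
split=> // J B uJ _ mB; rewrite mulr1; under eq_integral do rewrite mulr1.
have hE w : hits J B w = \1_(\bigcap_(i in [set` J]) (Y i @^-1` B i)) w.
  rewrite /hits indicE; case: (boolP (w \in _)) => h.
    rewrite big_seq big1// => k kJ; rewrite indicE mem_set//.
    by move: h; rewrite inE; apply.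
  have [k kJ kB] : exists2 k, k \in J & ~ B k (Y k w).
    apply: contrapT => hn; move/negP: h; apply; rewrite inE => k kJ.
    by apply: contrapT => kB; apply: hn; exists k.
  by rewrite (perm_big _ (perm_to_rem kJ)) big_cons indicE memNset//= mul0r.
under eq_integral do rewrite hE.
rewrite integral_indic//; last first.
  apply: bigcap_measurableType => k _.
  by rewrite -[X in measurable X]setTI; exact: mY.
rewrite setIT; apply: etrans (indY uJ mB) _.
have e k : P (Y k @^-1` B k) = (fine (Q (B k)))%:E.
  by rewrite lawY// fineK// Q_fin.
by rewrite (big_morph EFin (@EFinM R) erefl); apply: eq_bigr => k _; exact: e.
Qed.

Lemma ge0_indep_offD J h a h' a' : ge0_indep_off J h a -> ge0_indep_off J h' a' ->
  ge0_indep_off J (h \+ h') (a + a').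
Proof.
move=> [mh h0 hJ] [mh' h0' hJ']; split.
- exact: measurable_funD.
- by move=> w; rewrite addr_ge0.
move=> J' B uJ J'J mB; rewrite mulrDr EFinD -hJ// -hJ'//.
under eq_integral do rewrite /= mulrDr EFinD.
rewrite ge0_integralD//.
- by move=> w _; rewrite lee_fin mulr_ge0.
- by apply/measurable_EFinP; apply: measurable_funM => //; exact: measurable_hits.
- by move=> w _; rewrite lee_fin mulr_ge0.
- by apply/measurable_EFinP; apply: measurable_funM => //; exact: measurable_hits.
Qed.

Lemma ge0_indep_offM J h a j (g : R -> R) b : ge0_indep_off J h a -> j \notin J ->
  measurable_fun setT g -> (forall y, 0 <= g y) ->
  (\int[Q]_y (g y)%:E = b%:E)%E ->
  ge0_indep_off (j :: J) (fun w => g (Y j w) * h w) (b * a).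
Proof.
move=> hf jJ mg g0 gb; have a0 := ge0_indep_off_ge0 hf; case: hf => mh h0 hJ.
split.
- by apply: measurable_funM => //; exact: measurableT_comp.
- by move=> w; rewrite mulr_ge0.
move=> J' B uJ' J'J mB.
have jJ' : j \notin J' by apply/negP => /J'J; rewrite inE eqxx.
set c := \prod_(k <- J') fine (Q (B k)) * a.
have c0 : 0 <= c by rewrite mulr_ge0// prodr_ge0// => k _; rewrite fine_ge0.
rewrite mulrCA -/c (mulrC b).
have := @ge0_integral_transfer _ _ _ _ R P Q (Y j) (fun w => hits J' B w * h w) c.
rewrite -/c => /(_ (mY j) _ _ c0 _ g mg g0) tr.
rewrite EFinM -gb -tr.
- by apply: eq_integral => w _; rewrite mulrCA.
- by apply: measurable_funM => //; exact: measurable_hits.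
- by move=> w; rewrite mulr_ge0.
move=> C mC.
(* The indicator of [C] at index [j] joins those of [J'], which [h] is known to be
   independent of. *)
pose B' k := if k == j then C else B k.
have mB' k : measurable (B' k) by rewrite /B'; case: ifP => _; [exact: mC|exact: mB].
have := hJ (j :: J') B' _ _ mB'; rewrite /= jJ' uJ' => /(_ isT) hh.
transitivity (\int[P]_w (hits (j :: J') B' w * h w)%:E)%E.
  apply: eq_integral => w _; rewrite /hits big_cons mulrA {1}/B' eqxx.
  congr ((_ * _ * _)%:E); apply: eq_big_seq => k kJ'.
  by rewrite /B' ifN//; apply: contraNneq jJ' => <-.
rewrite hh; last first.
  move=> k; rewrite inE => /orP[/eqP->//|/J'J]; by rewrite inE negb_or => /andP[].
rewrite big_cons /c -[Q C]fineK; last exact: Q_fin.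
rewrite -EFinM; congr EFin.
rewrite {1}/B' eqxx -mulrA [RHS]mulrC; congr (_ * (_ * _)).
apply: eq_big_seq => k kJ'.
by rewrite /B' ifN//; apply: contraNneq jJ' => <-.
Qed.

(** Signed functions are handled as differences: the class of differences is stable
    under multiplication by a function of a further variable, as the four products
    of positive and negative parts regroup. *)
Definition indep_off (J : seq nat) (h : T -> R) (a : R) : Prop :=
  exists h1 h2 a1 a2, [/\ ge0_indep_off J h1 a1, ge0_indep_off J h2 a2,
    h = h1 \- h2 & a = a1 - a2].

Lemma indep_off1 : indep_off [::] (fun=> 1) 1.
Proof.
exists (fun=> 2), (fun=> 1), 2, 1; split.
- have e : (fun=> 2) = (fun=> 1) \+ (fun=> 1) :> (T -> R) by apply/funext.
  by rewrite e; apply: ge0_indep_offD ge0_indep_off1 ge0_indep_off1.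
- exact: ge0_indep_off1.
- by apply/funext => w /=; rewrite -natr1 addrK.
- by rewrite -natr1 addrK.
Qed.

Lemma indep_offM J h a j (g : R -> R) : indep_off J h a -> j \notin J ->
  Q.-integrable setT (fun y => (g y)%:E) ->
  indep_off (j :: J) (fun w => g (Y j w) * h w) (fine (\int[Q]_y (g y)%:E) * a).
Proof.
move=> [h1 [h2 [a1 [a2 [f1 f2 -> ->]]]]] jJ ig.
have mg : measurable_fun setT g.
  by have /measurable_EFinP mg := measurable_int _ ig; exact: mg.
have mgp : measurable_fun setT (g ^\+) by exact: measurable_funrpos.
have mgn : measurable_fun setT (g ^\-) by exact: measurable_funrneg.
have gp0 y : 0 <= (g ^\+) y by exact: funrpos_ge0.
have gn0 y : 0 <= (g ^\-) y by exact: funrneg_ge0.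
have igp := integrable_funrpos measurableT ig.
have ign := integrable_funrneg measurableT ig.
have fp := integrable_fin_num measurableT igp.
have fn := integrable_fin_num measurableT ign.
set bp := (\int[Q]_y ((g ^\+) y)%:E)%E in fp.
set bn := (\int[Q]_y ((g ^\-) y)%:E)%E in fn.
have hp : (\int[Q]_y ((g ^\+) y)%:E = (fine bp)%:E)%E by rewrite fineK.
have hn : (\int[Q]_y ((g ^\-) y)%:E = (fine bn)%:E)%E by rewrite fineK.
have gE y : g y = (g ^\+) y - (g ^\-) y.
  rewrite /funrpos /funrneg /=; have [gy|/ltW gy] := leP 0 (g y).
    by rewrite (max_idPr _) ?oppr_le0// subr0.
  by rewrite (max_idPl _) ?oppr_ge0// sub0r opprK.
have bE : fine (\int[Q]_y (g y)%:E) = fine bp - fine bn.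
  rewrite -fineB//; congr fine; rewrite -integralB_EFin//.
  by apply: eq_integral => y _; rewrite -EFinB gE.
have pp := ge0_indep_offM f1 jJ mgp gp0 hp; have np := ge0_indep_offM f1 jJ mgn gn0 hn.
have pn := ge0_indep_offM f2 jJ mgp gp0 hp; have nn := ge0_indep_offM f2 jJ mgn gn0 hn.
have f1' := ge0_indep_offD pp nn; have f2' := ge0_indep_offD pn np.
do 4 eexists; split; [exact: f1'|exact: f2'| |].
- by apply/funext => w /=; rewrite gE; ring.
- by rewrite bE; ring.
Qed.

Lemma indep_off_int J h a : indep_off J h a ->
  P.-integrable setT (fun w => (h w)%:E) /\ (\int[P]_w (h w)%:E = a%:E)%E.
Proof.
move=> [h1 [h2 [a1 [a2 [f1 f2 -> ->]]]]].
have int k b : ge0_indep_off J k b -> P.-integrable setT (fun w => (k w)%:E).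
  move=> fk; have e := ge0_indep_off_int fk; case: fk => mk k0 _.
  apply/integrableP; split; first exact/measurable_EFinP.
  under eq_integral do rewrite /= ger0_norm//.
  by rewrite e ltry.
have i1 := int _ _ f1; have i2 := int _ _ f2; split.
  by under eq_fun do rewrite /= EFinB; exact: integrableB.
rewrite EFinB -(ge0_indep_off_int f1) -(ge0_indep_off_int f2) -integralB_EFin//.
Qed.

Lemma indep_off_prod (J : seq nat) (g : nat -> R -> R) : uniq J ->
  (forall j, Q.-integrable setT (fun y => (g j y)%:E)) ->
  indep_off J (fun w => \prod_(j <- J) g j (Y j w))
            (\prod_(j <- J) fine (\int[Q]_y (g j y)%:E)).
Proof.
move=> + ig; elim: J => [_|j J ih /= /andP[jJ uJ]].
  rewrite big_nil (_ : (fun w => _) = fun=> 1); first exact: indep_off1.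
  by apply/funext => w; rewrite big_nil.
rewrite big_cons; under eq_fun do rewrite big_cons.
exact: indep_offM (ih uJ) jJ (ig j).
Qed.

Lemma integral_prod_indep (J : seq nat) (g : nat -> R -> R) : uniq J ->
  (forall j, Q.-integrable setT (fun y => (g j y)%:E)) ->
  P.-integrable setT (fun w => (\prod_(j <- J) g j (Y j w))%:E) /\
  (\int[P]_w (\prod_(j <- J) g j (Y j w))%:E
    = (\prod_(j <- J) fine (\int[Q]_y (g j y)%:E))%:E)%E.
Proof. by move=> uJ ig; apply: indep_off_int; exact: indep_off_prod. Qed.

End Independence.

Lemma integral_cst_probability d (T : measurableType d) (R : realType)
    (P : probability T R) (c : R) : (\int[P]_w c%:E = c%:E)%E.
Proof.
rewrite integral_cst// [X in (_ * X)%E](_ : _ = 1%E) ?mule1//.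
exact: (@probability_setT _ _ _ P).
Qed.

Section NormalMoments.
Variable R : realType.
Let Q : probability (measurableTypeR R) R := normal_prob 0 1.

Lemma integral_std_normal (g : R -> R) :
  measurable_fun setT g -> (forall y, 0 <= g y) ->
  (\int[Q]_y (g y)%:E
     = \int[lebesgue_measure]_x (g x * normal_pdf 0 1 x)%:E)%E.
Proof.
move=> mg g0; symmetry.
rewrite -[RHS]mul1e.
apply: (@ge0_integral_transfer _ _ _ _ R (@lebesgue_measure R) Q id
   (normal_pdf 0 1) 1) => //.
- exact: measurable_normal_pdf.
- by move=> x; exact: normal_pdf_ge0.
- move=> B mB; rewrite mul1e /Q /normal_prob [RHS]integral_mkcond.
  apply: eq_integral => x _; rewrite /patch /= indicE.
  by case: (x \in B); rewrite ?mul1r ?mul0r.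
Qed.

Lemma normal_exp_shift (m : R) :
  (\int[Q]_y (expR (m * y - m ^+ 2 / 2))%:E = 1)%E.
Proof.
rewrite integral_std_normal; last by move=> y; exact: expR_ge0.
  rewrite -(integral_normal_pdf m (1 : R)).
  apply: eq_integral => x _; congr EFin.
  rewrite !normal_pdfE ?oner_eq0// /normal_fun mulrCA; congr (_ * _).
  by rewrite -expRD; congr expR; rewrite expr1n; field.
by apply: measurableT_comp => //; apply: measurable_funB => //.
Qed.

Lemma normal_exp_scale (s : R) : 0 < s ->
  (\int[Q]_y (expR ((1 - s ^- 2) / 2 * y ^+ 2))%:E = s%:E)%E.
Proof.
move=> s0; have sn0 : s != 0 by rewrite gt_eqF.
rewrite integral_std_normal; last by move=> y; exact: expR_ge0.
  rewrite -[RHS]mule1 -(integral_normal_pdf 0 s).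
  rewrite -(integralZl measurableT (integrable_normal_pdf 0 s)).
  apply: eq_integral => x _; rewrite -EFinM; congr EFin.
  rewrite !normal_pdfE ?oner_eq0// /normal_fun mulrCA [RHS]mulrA.
  have -> : s * normal_peak s = normal_peak 1.
    rewrite /normal_peak expr1n mul1r -mulrnAr sqrtrM ?sqr_ge0// sqrtr_sqr gtr0_norm//.
    by rewrite invfM mulrA mulfV// mul1r.
  congr (_ * _); rewrite -expRD; congr expR.
  by rewrite expr1n; field.
by apply: measurableT_comp => //; apply: measurable_funM => //; exact: measurable_funX.
Qed.

Lemma integrable_normal_exp_scale (s : R) : 0 < s ->
  Q.-integrable setT (fun y => (expR ((1 - s ^- 2) / 2 * y ^+ 2))%:E).
Proof.
move=> s0; apply/integrableP; split.
  apply/measurable_EFinP.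
  by apply: measurableT_comp => //; apply: measurable_funM => //; exact: measurable_funX.
under eq_integral do rewrite /= ger0_norm ?expR_ge0//.
by rewrite normal_exp_scale// ltry.
Qed.

(** For [s^2 = 2] the integrable function of the previous lemma is [exp (y^2 / 4)],
    which dominates [1 + y^4 / 32]. *)
Lemma integrable_normal_pow k : (k <= 4)%N ->
  Q.-integrable setT (fun y : R => (y ^+ k)%:E).
Proof.
move=> k4.
have s2 : 0 < Num.sqrt 2 :> R by rewrite sqrtr_gt0.
have := integrableZl measurableT 32 (integrable_normal_exp_scale s2).
apply: le_integrable => //.
  by apply/measurable_EFinP; exact: measurable_funX.
move=> y _ /=; rewrite lee_fin [leRHS]ger0_norm; last first.
  by rewrite mulr_ge0// expR_ge0.
have -> : (1 - Num.sqrt 2 ^- 2) / 2 * y ^+ 2 = y ^+ 2 / 4.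
  by rewrite sqr_sqrtr//; field.
have := @expR_ge1Dxn R (y ^+ 2 / 4) 1; rewrite divr_ge0 ?sqr_ge0// => /(_ isT).
have -> : (y ^+ 2 / 4) ^+ 2 / 2`!%:R = `|y| ^+ 4 / 32.
  have -> : `|y| ^+ 4 = (y ^+ 2) ^+ 2.
    by rewrite -[4%N]/(2 * 2)%N exprM real_normK ?num_real.
  by rewrite -[2`!]/2%N; field.
move=> h; rewrite normrX; apply: (@le_trans _ _ (1 + `|y| ^+ 4)); last first.
  by have : 0 <= `|y| ^+ 4 by []; lra.
have [y1|y1] := leP `|y| 1.
  by apply: (@le_trans _ _ 1); [exact: exprn_ile1|rewrite lerDl].
apply: (@le_trans _ _ (`|y| ^+ 4)); last by rewrite lerDr.
by rewrite ler_weXn2l// ltW.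
Qed.

(** The mean [e] satisfies [1 + t e - t^2 / 2 <= 1] for every [t], by
    [1 + u <= exp u] and the mass of the density shifted by [t]; take [t = e]. *)
Lemma normal_mean : (\int[Q]_y (y ^+ 1)%:E = 0)%E.
Proof.
have i1 := integrable_normal_pow (isT : 1 <= 4)%N.
have fin := integrable_fin_num measurableT i1.
set e := (\int[Q]_y _)%E in fin *.
suff h m : m * fine e <= m ^+ 2 / 2.
  have e0 : fine e = 0.
    have := h (fine e); rewrite expr2 => h1.
    by apply/eqP; rewrite -sqrf_eq0 eq_le sqr_ge0 andbT expr2; lra.
  by rewrite -(fineK fin) e0.
have ic c : Q.-integrable setT (fun=> c%:E) by exact: finite_measure_integrable_cst.
have ie := integrableZl measurableT m i1.
suff : ((1 + m * fine e - m ^+ 2 / 2)%:E <= 1%:E)%E by rewrite lee_fin; lra.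
rewrite -(normal_exp_shift m).
have -> : ((1 + m * fine e - m ^+ 2 / 2)%:E
    = \int[Q]_y (1%:E + m%:E * (y ^+ 1)%:E - (m ^+ 2 / 2)%:E))%E.
  rewrite integralB//; last exact: integrableD.
  rewrite integralD// integralZl// !integral_cst_probability.
  by rewrite -/e EFinB EFinD EFinM fineK.
apply: le_integral => //.
- by apply: integrableB => //; exact: integrableD.
- apply/integrableP; split.
    apply/measurable_EFinP; apply: measurableT_comp => //.
    by apply: measurable_funB => //.
  under eq_integral do rewrite /= ger0_norm ?expR_ge0//.
  by rewrite normal_exp_shift ltry.
- move=> y _; apply: (@le_trans _ _ (1 + m * y ^+ 1 - m ^+ 2 / 2)%:E).
    by rewrite EFinB EFinD EFinM.
  by rewrite lee_fin expr1 -addrA expR_ge1Dx.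
Qed.

(** The second moment [e] satisfies [1 + (1 - s^-2) / 2 * e <= s] for every positive
    [s], by [1 + u <= exp u] and the mass of the density rescaled by [s]; letting [s]
    tend to [1] from either side forces [e = 1]. *)
Lemma normal_second_moment : (\int[Q]_y (y ^+ 2)%:E = 1)%E.
Proof.
have i2 := integrable_normal_pow (isT : 2 <= 4)%N.
have fin := integrable_fin_num measurableT i2.
set e := (\int[Q]_y _)%E in fin *.
have h s : 0 < s -> (1 - s ^- 2) / 2 * fine e <= s - 1.
  move=> s0; set c := (1 - s ^- 2) / 2.
  have ic : Q.-integrable setT (fun=> 1%:E) by exact: finite_measure_integrable_cst.
  have ie := integrableZl measurableT c i2.
  suff : (1%:E + (c * fine e)%:E <= s%:E :> \bar R)%E.
    by rewrite -EFinD lee_fin; lra.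
  rewrite -(normal_exp_scale s0).
  have -> : (1%:E + (c * fine e)%:E = \int[Q]_y (1%:E + c%:E * (y ^+ 2)%:E))%E.
    rewrite integralD// integralZl// integral_cst_probability.
    by rewrite -/e EFinM fineK.
  apply: le_integral => //.
  - exact: integrableD.
  - exact: integrable_normal_exp_scale.
  - by move=> y _; rewrite -EFinM -EFinD lee_fin expR_ge1Dx.
have h2 s : 0 < s -> (s ^+ 2 - 1) * fine e <= 2 * s ^+ 2 * (s - 1).
  move=> s0; have := ler_wpM2l (ltW (exprn_gt0 2 s0)) (h _ s0).
  have -> : s ^+ 2 * ((1 - s ^- 2) / 2 * fine e) = (s ^+ 2 - 1) * fine e / 2.
    by field; rewrite gt_eqF.
  lra.
suff e1 : fine e = 1 by rewrite -(fineK fin) e1.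
apply/eqP; rewrite eq_le; apply/andP; split; rewrite leNgt; apply/negP => he.
  pose t := Num.min 1 ((fine e - 1) / 6).
  have t0 : 0 < t by rewrite lt_min ltr01 /=; lra.
  have t1 : t <= 1 by rewrite ge_min lexx.
  have t2 : t <= (fine e - 1) / 6 by rewrite ge_min lexx orbT.
  have : (2 + t) * fine e <= 2 * (1 + t) ^+ 2.
    rewrite -(ler_pM2l t0); have := h2 (1 + t); rewrite addr_gt0// => /(_ isT).
    have -> : ((1 + t) ^+ 2 - 1) * fine e = t * ((2 + t) * fine e) by ring.
    have -> : 2 * (1 + t) ^+ 2 * (1 + t - 1) = t * (2 * (1 + t) ^+ 2) by ring.
    by [].
  rewrite expr2; nra.
pose t := Num.min (1 / 2) ((1 - fine e) / 6).
have t0 : 0 < t by rewrite lt_min; apply/andP; split; lra.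
have t1 : t <= 1 / 2 by rewrite ge_min lexx.
have t2 : t <= (1 - fine e) / 6 by rewrite ge_min lexx orbT.
have : 2 * (1 - t) ^+ 2 <= (2 - t) * fine e.
  rewrite -(ler_pM2l t0); have := h2 (1 - t); rewrite subr_gt0.
  have -> : ((1 - t) ^+ 2 - 1) * fine e = - (t * ((2 - t) * fine e)) by ring.
  have -> : 2 * (1 - t) ^+ 2 * (1 - t - 1) = - (t * (2 * (1 - t) ^+ 2)) by ring.
  by rewrite lerN2; apply; lra.
rewrite expr2; nra.
Qed.

End NormalMoments.

(** * Second moments of linear and quadratic forms in the noise *)

Section HasMean.
Context d (T : measurableType d) (R : realType) (P : probability T R).

Definition has_mean (h : T -> R) (a : R) : Prop :=
  P.-integrable setT (fun w => (h w)%:E) /\ (\int[P]_w (h w)%:E = a%:E)%E.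

Lemma has_mean_cst a : has_mean (fun=> a) a.
Proof.
split; first exact: finite_measure_integrable_cst.
exact: integral_cst_probability.
Qed.

Lemma has_meanD h k a b : has_mean h a -> has_mean k b ->
  has_mean (fun w => h w + k w) (a + b).
Proof.
move=> [ih eh] [ik ek]; split.
  by under eq_fun do rewrite EFinD; exact: integrableD.
by under eq_integral do rewrite EFinD; rewrite integralD// eh ek EFinD.
Qed.

Lemma has_meanZ c h a : has_mean h a -> has_mean (fun w => c * h w) (c * a).
Proof.
move=> [ih eh]; split.
  by under eq_fun do rewrite EFinM; exact: integrableZl.
by under eq_integral do rewrite EFinM; rewrite integralZl// eh EFinM.
Qed.

Lemma has_meanB h k a b : has_mean h a -> has_mean k b ->
  has_mean (fun w => h w - k w) (a - b).
Proof.
move=> mh mk; rewrite -[- b]mulN1r.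
by under eq_fun do rewrite -[- k _]mulN1r; apply: has_meanD => //; exact: has_meanZ.
Qed.

Lemma has_mean_sum (I : finType) (h : I -> T -> R) (a : I -> R) :
  (forall i, has_mean (h i) (a i)) ->
  has_mean (fun w => \sum_i h i w) (\sum_i a i).
Proof.
move=> mh; elim: (index_enum I) => [|i s ih].
  by under eq_fun do rewrite big_nil; rewrite big_nil; exact: has_mean_cst.
by under eq_fun do rewrite big_cons; rewrite big_cons; exact: has_meanD.
Qed.

Lemma has_mean_sq_sum (I : finType) (X : I -> T -> R) (c : I -> R)
    (G : I -> I -> R) :
  (forall p q, has_mean (fun w => X p w * X q w) (G p q)) ->
  has_mean (fun w => (\sum_p c p * X p w) ^+ 2)
           (\sum_p \sum_q c p * c q * G p q).
Proof.
move=> h.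
have -> : (fun w => (\sum_p c p * X p w) ^+ 2) =
    (fun w => \sum_p \sum_q c p * c q * (X p w * X q w)).
  apply/funext => w; rewrite expr2 mulr_suml; apply: eq_bigr => p _.
  by rewrite mulr_sumr; apply: eq_bigr => q _; rewrite mulrACA.
by apply: has_mean_sum => p; apply: has_mean_sum => q; exact: has_meanZ.
Qed.

Lemma has_mean_markov (X : T -> R) (a t : R) : measurable_fun setT X ->
  has_mean (fun w => X w ^+ 2) a -> 0 < t ->
  (P [set w | (t <= `|X w|)%R] <= (a / t ^+ 2)%:E)%E.
Proof.
move=> mX [iX eX] t0; set A := [set w | _].
have mA : measurable A.
  have -> : A = (fun w => `|X w|) @^-1` `[t, +oo[%classic.
    by apply/seteqP; split => w /=; rewrite in_itv /= andbT.
  rewrite -[X in measurable X]setTI.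
  have mn : measurable_fun setT (fun w => `|X w|) by exact: measurableT_comp.
  exact: mn.
rewrite mulrC EFinM lee_pdivlMl ?exprn_gt0// -eX.
have -> : P A = (\int[P]_w (\1_A w)%:E)%E by rewrite integral_indic// setIT.
have t2 : 0 <= t ^+ 2 by rewrite sqr_ge0.
rewrite -ge0_integralZl_EFin//; last first.
  by apply/measurable_EFinP; exact: measurable_indic.
under eq_integral do rewrite -EFinM.
apply: ge0_le_integral => //=.
- by move=> w _; rewrite lee_fin mulr_ge0// exprn_ge0// ltW.
- by apply/measurable_EFinP; apply: measurable_funM => //; exact: measurable_indic.
- by apply/measurable_EFinP; exact: measurable_funX.
move=> w _; rewrite lee_fin indicE; case: (boolP (w \in A)).
  rewrite inE /A /= mulr1 -[X in _ -> _ <= X]real_normK ?num_real// => tX.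
  by rewrite lerXn2r// nnegrE// ltW.
by rewrite mulr0 sqr_ge0.
Qed.

End HasMean.

Section GaussianForms.
Context d (T : measurableType d) (R : realType) (P : probability T R)
  (eps : nat -> T -> R).
Hypothesis heps : iid_std_normal P eps.

Let Q : probability (measurableTypeR R) R := normal_prob 0 1.

Definition normal_moment k : R := fine (\int[Q]_y (y ^+ k)%:E).
Local Notation m := normal_moment.

Lemma normal_moment0 : m 0 = 1.
Proof.
rewrite /m; under eq_integral do rewrite expr0.
by rewrite integral_cst_probability.
Qed.

Lemma normal_moment1 : m 1 = 0.
Proof. by rewrite /m normal_mean. Qed.

Lemma normal_moment2 : m 2 = 1.
Proof. by rewrite /m normal_second_moment. Qed.

Lemma has_mean_monomial n (a : nat -> nat) : (forall j, (a j <= 4)%N) ->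
  has_mean P (fun w => \prod_(j <- iota 0 n) eps j w ^+ a j)
             (\prod_(j <- iota 0 n) m (a j)).
Proof.
move=> a4; case: heps => meps law ind.
have h := @integral_prod_indep _ _ _ P Q eps meps law ind (iota 0 n)
  (fun j y => y ^+ a j) (iota_uniq _ _).
exact: (h (fun j => integrable_normal_pow R (a4 j))).
Qed.

Lemma prod_pow_delta n (y : nat -> R) i : (i < n)%N ->
  \prod_(t <- iota 0 n) y t ^+ (t == i) = y i.
Proof.
move=> ni; rewrite (bigD1_seq i) ?iota_uniq ?mem_iota//= eqxx expr1.
by rewrite big1 ?mulr1// => t /negbTE ->.
Qed.

Lemma moment_prod_eq1 n (a : nat -> nat) :
  (forall t, a t = 0%N \/ a t = 2%N) -> \prod_(t <- iota 0 n) m (a t) = 1.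
Proof.
move=> ha; rewrite big1// => t _.
by case: (ha t) => ->; rewrite ?normal_moment0 ?normal_moment2.
Qed.

Lemma moment_prod_eq0 n (a : nat -> nat) i : (i < n)%N -> a i = 1%N ->
  \prod_(t <- iota 0 n) m (a t) = 0.
Proof.
move=> ni ai; rewrite (bigD1_seq i) ?iota_uniq ?mem_iota//= ai normal_moment1.
by rewrite mul0r.
Qed.

Lemma has_mean_pair n (i j : 'I_n) :
  has_mean P (fun w => eps i w * eps j w) (i == j)%:R.
Proof.
pose a t := ((t == i :> nat) + (t == j :> nat))%N.
have a4 t : (a t <= 4)%N by rewrite /a; lia.
have := has_mean_monomial n a4.
have -> : (fun w => \prod_(t <- iota 0 n) eps t w ^+ a t) =
    (fun w => eps i w * eps j w).
  apply/funext => w; under eq_bigr do rewrite exprD.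
  by rewrite big_split /= !(prod_pow_delta (fun t => eps t w)).
congr (has_mean _ _ _).
have [ij|ij] := eqVneq i j.
  by apply: moment_prod_eq1 => t; rewrite /a ij; case: eqVneq => _; [right|left].
apply: (@moment_prod_eq0 _ _ i) => //.
by rewrite /a eqxx; move: ij; rewrite -val_eqE => /negbTE ->.
Qed.

(** Wick's formula.  The last term vanishes for the Gaussian law; carrying it along
    makes the value of the fourth moment unnecessary. *)
Lemma has_mean_quad n (i j k l : 'I_n) :
  has_mean P (fun w => eps i w * eps j w * (eps k w * eps l w))
    ((i == j)%:R * (k == l)%:R + (i == k)%:R * (j == l)%:R
      + (i == l)%:R * (j == k)%:R
      + (m 4 - 3) * ((i == j) && (j == k) && (k == l))%:R).
Proof.
pose a t := ((t == i :> nat) + (t == j :> nat)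
             + ((t == k :> nat) + (t == l :> nat)))%N.
have a4 t : (a t <= 4)%N by rewrite /a; lia.
have := has_mean_monomial n a4.
have -> : (fun w => \prod_(t <- iota 0 n) eps t w ^+ a t) =
    (fun w => eps i w * eps j w * (eps k w * eps l w)).
  apply/funext => w; under eq_bigr do rewrite !exprD.
  by rewrite !big_split /= !(prod_pow_delta (fun t => eps t w)).
congr (has_mean _ _ _).
have uniq1 (p : 'I_n) : a p = 1%N -> \prod_(t <- iota 0 n) m (a t) = 0.
  by apply: moment_prod_eq0.
have neE (p q : 'I_n) : p != q -> (p == q :> nat) = false.
  by rewrite -val_eqE => /negbTE.
have [ij|ij] := eqVneq i j.
  subst j; have [kl|kl] := eqVneq k l.
    subst l; have [ik|ik] := eqVneq i k.
      subst k; rewrite (bigD1_seq (nat_of_ord i)) ?iota_uniq ?mem_iota//=.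
      rewrite big1 => [|t /negbTE ti]; last by rewrite /a ti normal_moment0.
      by rewrite /a eqxx /=; rewrite -[(1 + 1 + (1 + 1))%N]/4%N; ring.
    rewrite moment_prod_eq1 /=; first by rewrite ?mul0r ?mulr0; ring.
    move=> t; rewrite /a; case: eqVneq => [->|_].
      by rewrite (neE _ _ ik); right.
    by case: eqVneq => _; [right|left].
  rewrite !(mulr0, andbF, addr0, add0r).
  have [ik|ik] := eqVneq i k.
    subst k; rewrite (negbTE kl) !(mulr0, addr0, mul0r) (uniq1 l)//.
    by rewrite /a eqxx eq_sym (neE _ _ kl).
  rewrite (uniq1 k); first by rewrite /= !(mul0r, mulr0, addr0, add0r).
  by rewrite /a eqxx eq_sym (neE _ _ ik) (neE _ _ kl).
rewrite /= mul0r add0r mulr0 addr0.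
have [ik|ik] := eqVneq i k.
  subst k; have [jl|jl] := eqVneq j l.
    subst l; rewrite moment_prod_eq1 => [|t].
      by rewrite (negbTE ij) mul0r addr0 mulr1.
    rewrite /a; case: eqVneq => [->|_].
      by rewrite (neE _ _ ij); right.
    by case: eqVneq => _; [right|left].
  rewrite (uniq1 j); first by rewrite mulr0 add0r (eq_sym j i) (negbTE ij) mulr0.
  by rewrite /a eqxx eq_sym (neE _ _ ij) (neE _ _ jl).
rewrite mul0r add0r.
have [il|il] := eqVneq i l.
  subst l; have [jk|jk] := eqVneq j k.
    subst k; rewrite moment_prod_eq1 => [|t]; first by rewrite mulr1.
    rewrite /a; case: eqVneq => [->|_].
      by rewrite (neE _ _ ij); right.
    by case: eqVneq => _; [right|left].
  rewrite (uniq1 j) ?mulr0//.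
  by rewrite /a eqxx eq_sym (neE _ _ ij) (neE _ _ jk).
rewrite (uniq1 i) ?mul0r//.
by rewrite /a eqxx (neE _ _ ij) (neE _ _ ik) (neE _ _ il).
Qed.

End GaussianForms.

Section NoiseVector.
Context d (T : measurableType d) (R : realType) (P : probability T R)
  (eps : nat -> T -> R).
Hypothesis heps : iid_std_normal P eps.
Variable n : nat.

Definition noise (w : T) : 'cV[R]_n := \col_i eps i w.

Let meps i : measurable_fun setT (eps i).
Proof. by case: heps. Qed.

Lemma measurable_noise_linear (v : 'cV[R]_n) :
  measurable_fun setT (fun w => dot v (noise w)).
Proof.
under eq_fun do rewrite dotE.
apply: measurable_sum => i; apply: measurable_funM => //.
by rewrite (_ : (fun w => _) = eps i)//; apply/funext => w; rewrite mxE.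
Qed.

Lemma noise_quadE (A : 'M[R]_n) w : dot (noise w) (A *m noise w) =
  \sum_(p : 'I_n * 'I_n) A p.1 p.2 * (eps p.1 w * eps p.2 w).
Proof.
rewrite dotE -(pair_big xpredT xpredT
  (fun i j => A i j * (eps i w * eps j w))) /=.
apply: eq_bigr => i _; rewrite !mxE mulr_sumr; apply: eq_bigr => j _.
by rewrite !mxE mulrCA.
Qed.

Lemma measurable_noise_quad (A : 'M[R]_n) :
  measurable_fun setT (fun w => dot (noise w) (A *m noise w)).
Proof.
under eq_fun do rewrite noise_quadE.
by apply: measurable_sum => p; apply: measurable_funM => //; exact: measurable_funM.
Qed.

Lemma has_mean_noise_linear (v : 'cV[R]_n) :
  has_mean P (fun w => dot v (noise w) ^+ 2) (dot v v).
Proof.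
have -> : (fun w => dot v (noise w) ^+ 2) =
    (fun w => (\sum_i v i 0 * eps i w) ^+ 2).
  by apply/funext => w; rewrite dotE; under eq_bigr do rewrite mxE.
have := @has_mean_sq_sum _ T R P _ (fun (i : 'I_n) w => eps i w)
  (fun i => v i 0) (fun p q => (p == q)%:R) (fun p q => has_mean_pair heps p q).
congr (has_mean _ _ _); rewrite dotE; apply: eq_bigr => i _.
rewrite (bigD1 i)//= eqxx mulr1 big1 ?addr0// => j /negbTE ji.
by rewrite eq_sym ji mulr0.
Qed.

Lemma has_mean_noise_quad (A : 'M[R]_n) : A^T = A ->
  has_mean P (fun w => (dot (noise w) (A *m noise w) - \tr A) ^+ 2)
    (\sum_(p : 'I_n * 'I_n)
       (2 + (normal_moment R 4 - 3) * (p.1 == p.2)%:R) * A p.1 p.2 ^+ 2).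
Proof.
move=> symA.
pose X (p : 'I_n * 'I_n) w := eps p.1 w * eps p.2 w - (p.1 == p.2)%:R.
have -> : (fun w => (dot (noise w) (A *m noise w) - \tr A) ^+ 2) =
    (fun w => (\sum_(p : 'I_n * 'I_n) A p.1 p.2 * X p w) ^+ 2).
  apply/funext => w; congr (_ ^+ 2); rewrite noise_quadE.
  under [RHS]eq_bigr do rewrite mulrBr.
  rewrite sumrB; congr (_ - _).
  rewrite -(pair_big xpredT xpredT (fun i j => A i j * (i == j)%:R)) /=.
  apply: eq_bigr => i _; rewrite (bigD1 i)//= eqxx mulr1 big1 ?addr0// => j ji.
  by rewrite eq_sym (negbTE ji) mulr0.
pose G (p q : 'I_n * 'I_n) : R := (p.1 == q.1)%:R * (p.2 == q.2)%:R
  + (p.1 == q.2)%:R * (p.2 == q.1)%:R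
  + (normal_moment R 4 - 3) * ((p.1 == p.2) && (p.2 == q.1) && (q.1 == q.2))%:R.
have XG p q : has_mean P (fun w => X p w * X q w) (G p q).
  have := has_meanB (has_meanB (has_mean_quad heps p.1 p.2 q.1 q.2)
    (has_meanZ (p.1 == p.2)%:R (has_mean_pair heps q.1 q.2)))
    (has_meanB (has_meanZ (q.1 == q.2)%:R (has_mean_pair heps p.1 p.2))
      (has_mean_cst P ((p.1 == p.2)%:R * (q.1 == q.2)%:R))).
  congr (has_mean _ _ _); last by rewrite /G; ring.
  by apply/funext => w; rewrite /X; ring.
have := has_mean_sq_sum (fun p => A p.1 p.2) XG.
congr (has_mean _ _ _); apply: eq_bigr => p _.
have GE q : G p q = (p == q)%:R + ((p.2, p.1) == q)%:R
    + (normal_moment R 4 - 3) * (p.1 == p.2)%:R * (p == q)%:R.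
  rewrite /G; case: p q => [i j] [k l] /=; rewrite !xpair_eqE -!natrM !mulnb.
  congr (_ + _ + _); first by rewrite andbC.
  rewrite -mulrA -natrM mulnb; congr (_ * _%:R); congr nat_of_bool.
  have [ij|ij] //= := eqVneq i j; subst j.
  by have [ik|ik] //= := eqVneq i k; subst k.
have pick (r : 'I_n * 'I_n) : \sum_q A q.1 q.2 * (r == q)%:R = A r.1 r.2.
  rewrite (bigD1 r)//= eqxx mulr1 big1 ?addr0// => q /negbTE qr.
  by rewrite eq_sym qr mulr0.
transitivity (A p.1 p.2 * (A p.1 p.2 + A p.2 p.1
    + (normal_moment R 4 - 3) * (p.1 == p.2)%:R * A p.1 p.2)).
  pose c : R := (normal_moment R 4 - 3) * (p.1 == p.2)%:R.
  transitivity (\sum_q (A p.1 p.2 * (A q.1 q.2 * (p == q)%:R)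
      + A p.1 p.2 * (A q.1 q.2 * ((p.2, p.1) == q)%:R)
      + A p.1 p.2 * c * (A q.1 q.2 * (p == q)%:R))).
    by apply: eq_bigr => q _; rewrite GE -/c; ring.
  by rewrite !big_split /= -!mulr_sumr !pick -/c; ring.
have -> : A p.2 p.1 = A p.1 p.2 by rewrite -{1}symA mxE.
ring.
Qed.

Definition quad_const : R := 2 + `|normal_moment R 4 - 3|.

Lemma quad_const_ge0 : 0 <= quad_const.
Proof. by rewrite addr_ge0. Qed.

Lemma quad_variance_le (A : 'M[R]_n) : A^T = A ->
  \sum_(p : 'I_n * 'I_n)
    (2 + (normal_moment R 4 - 3) * (p.1 == p.2)%:R) * A p.1 p.2 ^+ 2
  <= quad_const * \tr (A *m A).
Proof.
move=> symA.
have -> : \tr (A *m A) = \sum_(p : 'I_n * 'I_n) A p.1 p.2 ^+ 2.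
  rewrite -(pair_big xpredT xpredT (fun i j => A i j ^+ 2)) /=.
  apply: eq_bigr => i _; rewrite mxE; apply: eq_bigr => j _.
  have -> : A j i = A i j by rewrite -{1}symA mxE.
  by rewrite expr2.
rewrite mulr_sumr; apply: ler_sum => p _.
rewrite ler_wpM2r ?sqr_ge0// /quad_const lerD2l.
by case: eqP => _; rewrite ?mulr1 ?mulr0 ?ler_norm.
Qed.

(** Where [|F|] is below [a / 2], the linear or the quadratic term is at least [a / 4] in
    absolute value; Chebyshev's inequality bounds the probability of either. *)
Lemma noise_form_tail (v : 'cV[R]_n) (A : 'M[R]_n) (a t : R) (F : T -> R) :
  A^T = A -> 0 < a -> t <= a / 2 ->
  (forall w, F w = a + dot v (noise w) + (dot (noise w) (A *m noise w) - \tr A)) ->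
  ((1 - 16 * (dot v v + quad_const * \tr (A *m A)) / a ^+ 2)%:E
     <= P [set w | (t <= `|F w|)%R])%E.
Proof.
move=> symA a0 ta FE.
set L := fun w => dot v (noise w).
set Qd := fun w => dot (noise w) (A *m noise w) - \tr A.
have mL : measurable_fun setT L by exact: measurable_noise_linear.
have mQ : measurable_fun setT Qd.
  by apply: measurable_funB => //; exact: measurable_noise_quad.
have mF : measurable_fun setT F.
  rewrite (_ : F = (fun w => a + L w + Qd w)); last exact/funext.
  by apply: measurable_funD => //; exact: measurable_funD.
have mabs (h : T -> R) (r : R) : measurable_fun setT h ->
    measurable [set w | (r <= `|h w|)%R].
  move=> mh.
  have -> : [set w | r <= `|h w|] = (fun w => `|h w|) @^-1` `[r, +oo[%classic.
    by apply/seteqP; split => w /=; rewrite in_itv /= andbT.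
  rewrite -[X in measurable X]setTI.
  have mn : measurable_fun setT (fun w => `|h w|) by exact: measurableT_comp.
  exact: mn.
have small l q : `|a + l + q| < t -> `|l| < a / 4 -> `|q| < a / 4 -> False.
  rewrite !ltr_norml => /andP[_ h1] /andP[h2 _] /andP[h3 _].
  by move: h1; apply/negP; rewrite -leNgt; lra.
have a4 : 0 < a / 4 by rewrite divr_gt0.
have PL := has_mean_markov mL (has_mean_noise_linear v) a4.
have PQ := has_mean_markov mQ (has_mean_noise_quad symA) a4.
set EL := [set w | _] in PL; set EQ := [set w | _] in PQ.
set EF := [set w | _].
have mEL : measurable EL by exact: mabs.
have mEQ : measurable EQ by exact: mabs.
have mEF : measurable EF by exact: mabs.
have cover : ~` EF `<=` EL `|` EQ.
  move=> w /= /negP; rewrite -ltNge => Ft.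
  have [h1|h1] := leP (a / 4) `|L w|; first by left.
  have [h2|h2] := leP (a / 4) `|Qd w|; first by right.
  by rewrite FE in Ft; case: (small _ _ Ft h1 h2).
have PC : (P (~` EF) <= P EL + P EQ)%E.
  apply: le_trans (measureU2 P mEL mEQ).
  by apply: le_measure; rewrite ?inE//; [exact: measurableC|exact: measurableU].
have Pf (E : set T) : measurable E -> P E = (fine (P E))%:E.
  by move=> mE; rewrite fineK// fin_num_measure.
move: PC PL PQ; rewrite probability_setC// (Pf EF)// (Pf EL)// (Pf EQ)//.
rewrite -EFinB -EFinD !lee_fin => h1 h2 h3.
have h4 := quad_variance_le symA.
have h5 : fine (P EQ) <= quad_const * \tr (A *m A) / (a / 4) ^+ 2.
  by apply: le_trans h3 _; rewrite ler_pM2r// invr_gt0 exprn_gt0.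
have -> : 16 * (dot v v + quad_const * \tr (A *m A)) / a ^+ 2 =
  dot v v / (a / 4) ^+ 2 + quad_const * \tr (A *m A) / (a / 4) ^+ 2.
  by field; rewrite gt_eqF.
lra.
Qed.

End NoiseVector.

(** * Probability of events of (a,b)-type *)

Section ConditionalEvents.
Local Open Scope ereal_scope.

(** On the event where the conditional probability is at least [1 - exp (- a)], which
    has probability at least [1 - exp (- b)], integrate it; then expand the product. *)
Lemma ab_type_prob d d' (T : measurableType d) (U : measurableType d')
    (R : realType) (P : probability T R) (X : T -> U) (E : set T)
    (a b : \bar R) : measurable_fun setT X -> 0 <= a ->
  ab_type P X E a b -> 1 - expeR (- a) - expeR (- b) <= P E.
Proof.
move=> mX a0 [mE [g [[mg hg] gb]]].
have ea_fin : expeR (- a) \is a fin_num.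
  by case: a a0 {gb} => [r| |].
set p := fine (expeR (- a)).
have pE : expeR (- a) = p%:E by rewrite fineK.
have p01 : (0 <= p <= 1)%R.
  rewrite -!lee_fin -pE expeR_ge0 /=.
  by rewrite -expeR0 ler_expeR oppe_le0.
move: gb; rewrite pE -EFinB.
set B := [set t : U | ((1 - p)%R <= g t)%R].
have mB : measurable B.
  have -> : B = g @^-1` `[(1 - p)%R, +oo[%classic.
    by apply/seteqP; split => w /=; rewrite in_itv /= andbT.
  by rewrite -[X in measurable X]setTI; exact: mg.
have -> : [set w | (1 - p)%:E <= (g (X w))%:E] = X @^-1` B.
  by apply/seteqP; split => w /=; rewrite lee_fin.
move=> hB.
have mXB : measurable (X @^-1` B) by rewrite -[X in measurable X]setTI; exact: mX.
have h1 : P (E `&` X @^-1` B) <= P E.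
  by apply: le_measure; rewrite ?inE//; exact: measurableI.
have h2 : (1 - p)%:E * P (X @^-1` B) <= P (E `&` X @^-1` B).
  rewrite hg// -integral_cst//; apply: ge0_le_integral => //.
  - by move=> w _; rewrite lee_fin; lra.
  - apply/measurable_EFinP; apply: measurable_funTS.
    exact: measurableT_comp.
have Pf (F : set T) : measurable F -> P F = (fine (P F))%:E.
  by move=> mF; rewrite fineK// fin_num_measure.
apply: le_trans h1; apply: le_trans h2; move: hB.
rewrite (Pf _ mXB); have := probability_le1 P mXB; rewrite (Pf _ mXB) lee_fin.
move: (fine _) => q q1.
have [->|bN] := eqVneq (expeR (- b)) +oo.
  by move=> _ /=; rewrite addeNy leNye.
have eb_fin : expeR (- b) \is a fin_num.
  by rewrite ge0_fin_numE ?expeR_ge0// ltey.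
rewrite -(fineK eb_fin); have := expeR_ge0 (- b).
rewrite -[X in _ <= X -> _](fineK eb_fin) lee_fin.
move: (fine _) => r r0; rewrite -!EFinB -EFinM !lee_fin => hq.
nra.
Qed.

End ConditionalEvents.

(** * Polynomial rates *)

Section PowerAsymptotics.
Variable R : realType.

Lemma theta_nneg (f g : nat -> R) : (forall n, 0 <= f n) -> (forall n, 0 <= g n) ->
  ((f : nat -> R^o) \is 'Theta_\oo (g : nat -> R^o)) <->
  exists k1 k2 N, [/\ 0 < k1, 0 < k2 &
    forall n, (N <= n)%N -> k1 * g n <= f n /\ f n <= k2 * g n].
Proof.
move=> f0 g0; split.
  rewrite qualifE => /asboolP[[k1 k2] /= /andP[k10 k20] [N _ hN]].
  exists k1, k2, N; split=> // n Nn; have := hN n Nn.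
  by rewrite /= !ger0_norm.
move=> [k1 [k2 [N [k10 k20 h]]]]; rewrite qualifE; apply/asboolP.
exists (k1, k2) => /=; first by rewrite k10.
by exists N => // n /= Nn; rewrite !ger0_norm//; exact: h.
Qed.

Lemma powR_large (g A : R) : 0 < g ->
  exists N, forall n, (N <= n)%N -> A <= n%:R `^ g.
Proof.
move=> g0; pose B := Num.max A 0; have B0 : 0 <= B by rewrite le_max lexx orbT.
exists (Num.truncn (B `^ g^-1)).+1 => n Nn.
apply: (@le_trans _ _ B); first by rewrite le_max lexx.
have -> : B = (B `^ g^-1) `^ g by rewrite -powRrM mulVf ?powRr1// gt_eqF.
apply: ge0_ler_powR; rewrite ?nnegrE ?powR_ge0 ?(ltW g0)//.
have /andP[_ /ltW h] := truncn_itv (powR_ge0 B g^-1).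
by apply: le_trans h _; rewrite ler_nat.
Qed.

Lemma powRN_le (x y r : R) : 0 < x -> x <= y -> 0 <= r -> y `^ (- r) <= x `^ (- r).
Proof.
move=> x0 xy r0; have y0 : 0 < y by apply: lt_le_trans xy.
rewrite !powRN lef_pV2 ?posrE ?powR_gt0//.
by apply: ge0_ler_powR; rewrite ?nnegrE ?(ltW x0) ?(ltW y0).
Qed.

Lemma powRN_lt (x y r : R) : 0 < x -> x < y -> 0 < r -> y `^ (- r) < x `^ (- r).
Proof.
move=> x0 xy r0; have y0 : 0 < y by apply: lt_trans xy.
rewrite !powRN ltf_pV2 ?posrE ?powR_gt0//.
by apply: gt0_ltr_powR; rewrite ?nnegrE ?(ltW x0) ?(ltW y0).
Qed.

(** In terms of [t = n^(2 / (4 m + 1))], the order of [s_lambda], the critical [lambda]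
    is [t^(- 2 m)], the size of the eigenvalue of index [t]. *)
Lemma lambda_starE (m : R) n : 0 < m ->
  lambda_star m n = (n%:R `^ (2 / (4 * m + 1))) `^ (- (2 * m)).
Proof.
move=> m0; rewrite /lambda_star -powRrM; congr (_ `^ _).
by field; rewrite gt_eqF//; lra.
Qed.

Lemma s_lambda_spec (mu : nat -> R) lam i : mu i <= lam ->
  [/\ mu (s_lambda mu lam) <= lam & (s_lambda mu lam <= i)%N].
Proof.
move=> mui; have ex : exists i, mu i <= lam by exists i.
case: (ex_minnP ex) => j muj minj.
have h : [set i | mu i <= lam /\ forall j, (j < i)%N -> lam < mu j] j.
  split=> // k kj; rewrite ltNge; apply/negP => /minj; lia.
rewrite /s_lambda; case: (xgetPex 0%N (ex_intro _ j h)) => h1 h2; split=> //.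
by rewrite leqNgt; apply/negP => /h2; rewrite ltNge mui.
Qed.

Variables (m : R) (mu : nat -> R).
Hypotheses (m_gt0 : 0 < m) (mu_ge0 : forall i, 0 <= mu i)
  (mu_ni : nonincreasing_seq mu)
  (hmu : (mu : nat -> R^o) \is
       'Theta_\oo (fun i : nat => i.+1%:R `^ (- (2 * m)) : R^o)).

Let g := 2 / (4 * m + 1).
Let g_gt0 : 0 < g.
Proof. by rewrite /g divr_gt0// addr_gt0// mulr_gt0. Qed.
Let m2_gt0 : 0 < 2 * m. Proof. by rewrite mulr_gt0. Qed.

Lemma s_lambda_star_theta :
  (fun n : nat => (s_lambda mu (lambda_star m n))%:R : R^o) \is
     'Theta_\oo (fun n : nat => n%:R `^ (2 / (4 * m + 1)) : R^o).
Proof.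
have [c1 [c2 [N [c10 c20 hN]]]] :=
  (theta_nneg mu_ge0 (fun n => powR_ge0 n.+1%:R (- (2 * m)))).1 hmu.
apply/theta_nneg => //.
pose b1 := c1 `^ (2 * m)^-1; pose b2 := c2 `^ (2 * m)^-1.
have b1_gt0 : 0 < b1 by exact: powR_gt0.
have b2_gt0 : 0 < b2 by exact: powR_gt0.
have b1E : b1 `^ (- (2 * m)) = c1^-1.
  by rewrite -powRrM mulrN mulVf ?gt_eqF// powR_inv1// ltW.
have b2E : b2 `^ (- (2 * m)) = c2^-1.
  by rewrite -powRrM mulrN mulVf ?gt_eqF// powR_inv1// ltW.
have [N1 hN1] := powR_large (Num.max 1 (2 * N.+1%:R / b1)) g_gt0.
exists (b1 / 2), (b2 + N%:R), N1; split=> [||n Nn].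
- by rewrite divr_gt0.
- by rewrite ltr_wpDr.
have := hN1 _ Nn; rewrite -/g; set a := n%:R `^ g.
rewrite ge_max => /andP[a1 aN].
have a0 : 0 < a by exact: lt_le_trans ltr01 a1.
have lamE : lambda_star m n = a `^ (- (2 * m)) by rewrite lambda_starE.
have ba (b : R) : 0 < b -> (b * a) `^ (- (2 * m)) = b `^ (- (2 * m)) * lambda_star m n.
  by move=> b0; rewrite powRM ?ltW// lamE.
pose i := (Num.truncn (b2 * a) + N)%N.
have mui : mu i <= lambda_star m n.
  have [_ h] := hN i (leq_addl _ _); apply: le_trans h _.
  have h2 : b2 * a <= i.+1%:R.
    have /andP[_ /ltW h] := truncn_itv (ltW (mulr_gt0 b2_gt0 a0)).
    by apply: le_trans h _; rewrite ler_nat ltnS /i leq_addr.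
  have := powRN_le (mulr_gt0 b2_gt0 a0) h2 (ltW m2_gt0).
  rewrite ba// b2E => h3; rewrite -ler_pdivlMl//.
have [mus si] := s_lambda_spec mui; set s := s_lambda _ _ in mus si *.
split; last first.
  apply: (@le_trans _ _ i%:R); first by rewrite ler_nat.
  rewrite /i natrD mulrDl; apply: lerD; last by rewrite ler_peMr.
  by have /andP[] := truncn_itv (ltW (mulr_gt0 b2_gt0 a0)).
(* The power bounds hold from [N] on; at [maxn s N] the eigenvalue is still at most
   [lambda_star], by monotonicity. *)
pose k := maxn s N.
have muk : mu k <= lambda_star m n.
  by apply: le_trans mus; apply: mu_ni; exact: leq_maxl.
have bk : b1 * a <= k.+1%:R.
  rewrite leNgt; apply/negP => kb.
  have := powRN_lt _ kb m2_gt0; rewrite ltr0n => /(_ isT).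
  rewrite ba// b1E; have [h _] := hN k (leq_maxr _ _).
  by rewrite ltr_pdivrMl// ltNge (le_trans h muk).
have ks : k.+1%:R <= s%:R + N.+1%:R :> R.
  by rewrite -natrD ler_nat addnS ltnS geq_max leq_addr leq_addl.
have Nb : N.+1%:R <= b1 / 2 * a.
  by rewrite mulrAC ler_pdivlMr// mulrC (mulrC b1) -ler_pdivrMr.
rewrite -(lerD2r N.+1%:R); apply: le_trans (le_trans bk ks).
by rewrite [in leRHS](splitr b1) mulrDl lerD2l.
Qed.

(** The cut-off is the integer part of [n^(2 / (4 m + 1))]: there the eigenvalue is of
    the order of [lam], so by the tail assumption the part beyond the cut-off
    contributes no more than the part before it. *)
Lemma tail_asymptotics (M M' : R) (lam : nat -> R) :
  (forall n, 0 < lam n) ->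
  (lam : nat -> R^o) \is 'Theta_\oo (lambda_star m : nat -> R^o) ->
  (forall k : nat,
     (\sum_(k.+1 <= i <oo) (mu i)%:E <= (M' * (k.+1%:R * mu k))%:E)%E) ->
  exists C N, 0 < C /\ forall n, (N <= n)%N -> exists k T,
    (forall N', \sum_(j < N' | (k <= j)%N) mu j <= T) /\
    k%:R + M ^+ 2 * T / lam n <= C * n%:R `^ (2 / (4 * m + 1)).
Proof.
move=> lam0 hlam hM.
have [c1 [c2 [N [c10 c20 hN]]]] :=
  (theta_nneg mu_ge0 (fun n => powR_ge0 n.+1%:R (- (2 * m)))).1 hmu.
have [l1 [l2 [N2 [l10 l20 hN2]]]] := (theta_nneg (fun n => ltW (lam0 n))
  (fun n => powR_ge0 n%:R (- (4 * m / (4 * m + 1))))).1 hlam.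
pose M1 := Num.max M' 0; have M10 : 0 <= M1 by rewrite le_max lexx orbT.
have [N1 hN1] := powR_large (N.+1%:R) g_gt0.
have D0 : 0 <= M ^+ 2 * M1 * c2 / l1.
  apply: divr_ge0; last exact: ltW.
  by apply: mulr_ge0; [apply: mulr_ge0 => //; exact: sqr_ge0|exact: ltW].
exists (2 * (1 + M ^+ 2 * M1 * c2 / l1)), (maxn N1 N2); split.
  by rewrite mulr_gt0// ltr_wpDr.
move=> n; rewrite geq_max => /andP[/hN1 + /hN2[lamge _]].
rewrite -/g; set a := n%:R `^ g => aN.
have a1 : 1 <= a by apply: le_trans aN; rewrite ler1n.
have a0 : 0 < a by exact: lt_le_trans ltr01 a1.
have lamE : lambda_star m n = a `^ (- (2 * m)) by rewrite lambda_starE.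
have lams_gt0 : 0 < lambda_star m n by rewrite lamE powR_gt0.
pose k := Num.truncn a.
have /andP[ka ak] : k%:R <= a < k.+1%:R by apply: truncn_itv; exact: ltW.
have Nk : (N <= k)%N.
  rewrite -ltnS -(ltr_nat R); apply: le_lt_trans ak; apply: le_trans aN.
  by rewrite ler_nat.
have muk : mu k <= c2 * lambda_star m n.
  have [_ h] := hN k Nk; apply: le_trans h _; rewrite ler_pM2l// lamE.
  by apply: powRN_le => //; exact: ltW.
have k2 : k.+1%:R <= 2 * a by rewrite -natr1 mulr_natl mulr2n lerD.
pose T := M1 * (2 * a * (c2 * lambda_star m n)).
exists k.+1, T; split.
  move=> N'; rewrite -lee_fin.
  apply: (@le_trans _ _ (M' * (k.+1%:R * mu k))%:E).
    apply: le_trans (hM k).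
    have := @nneseries_lim_ge R (fun i => (mu i)%:E) xpredT k.+1 N'.
    rewrite big_geq_mkord /= sumEFin; apply.
    by move=> i _ _; rewrite lee_fin.
  rewrite lee_fin; apply: (@le_trans _ _ (M1 * (k.+1%:R * mu k))).
    by rewrite ler_wpM2r ?mulr_ge0// le_max lexx.
  by rewrite ler_wpM2l// ler_pM.
have h : M ^+ 2 * T / lam n <= 2 * (M ^+ 2 * M1 * c2 / l1) * a.
  rewrite ler_pdivrMr//.
  have -> : M ^+ 2 * T = 2 * (M ^+ 2 * M1 * c2 / l1) * a * (l1 * lambda_star m n).
    by rewrite /T; field; rewrite gt_eqF.
  apply: ler_wpM2l lamge; apply: mulr_ge0; last exact: ltW.
  exact: mulr_ge0.
by rewrite mulrDr mulr1 mulrDl lerD.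
Qed.

End PowerAsymptotics.

(** * Decomposition and power of the test *)

Section Statistic.
Context (R : realType) (d n s : nat) (K : d.-tuple R -> d.-tuple R -> R)
  (lam : R) (x : n.-tuple (d.-tuple R)) (S : 'M[R]_(s, n)).
Hypotheses (n_gt0 : (0 < n)%N) (lam_gt0 : 0 < lam)
  (symK : (gram K x)^T = gram K x) (psdK : psd (gram K x)).

Let n_neq0 : n%:R != 0 :> R. Proof. by rewrite pnatr_eq0 -lt0n. Qed.

Let D := ridge_smoother (gram K x) S lam.

Lemma Delta_ridge_smoother : Delta K lam x S = D.
Proof. by []. Qed.

Lemma T_statE (y : 'cV[R]_n) : T_stat K lam x S y = dot (D *m y) (D *m y) / n%:R.
Proof.
rewrite /T_stat /emp_norm sqr_sqrtr; last first.
  by rewrite mulr_ge0 ?invr_ge0// sumr_ge0// => i _; rewrite sqr_ge0.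
rewrite mulrC dotE; congr (_ / _); apply: eq_bigr => j _.
rewrite -expr2; congr (_ ^+ 2); rewrite /f_hat.
have -> : D *m y = gram K x *m (n%:R *: (S^T *m beta_hat K lam x S y)).
  rewrite /beta_hat -!scalemxAr scalerA divff// scale1r /D /ridge_smoother.
  by rewrite !mulmxA.
rewrite mxE; apply: eq_bigr => i _; rewrite !mxE.
by rewrite mulrACA mulVf// mul1r mulrC.
Qed.

Lemma T_stat_decomposition (f e : 'cV[R]_n) :
  T_stat K lam x S (f + e) - mu_stat K lam x S =
  dot (D *m f) (D *m f) / n%:R
  + dot ((2 / n%:R) *: (D *m (D *m f))) e
  + (dot e ((n%:R^-1 *: (D *m D)) *m e) - \tr (n%:R^-1 *: (D *m D))).
Proof.
have symD : D^T = D by exact: ridge_smoother_sym.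
rewrite T_statE /mu_stat Delta_ridge_smoother expr2 -mulmxE.
move: symD; generalize D => E symE; rewrite mulmxDr !dotD.
rewrite (dotC (E *m e)) !(dot_adj E _) symE -scalemxAl dotZr mxtraceZ.
have -> : dot f (E *m (E *m e)) = dot (E *m (E *m f)) e.
  by rewrite [RHS]dot_adj symE dot_adj symE.
rewrite -!mulmxA.
by field; exact: n_neq0.
Qed.

Lemma sigma_stat_le : sigma_stat K lam x S <= Num.sqrt (2 * \tr D / n%:R ^+ 2).
Proof.
rewrite /sigma_stat Delta_ridge_smoother ler_wsqrtr//.
rewrite ler_wpM2r ?invr_ge0 ?exprn_ge0// ler_wpM2l//.
exact: tr_ridge_smoother4.
Qed.

(** Both variances of [noise_form_tail] simplify because [D] is a contraction: the linear
    form is that of [2 D^2 f / n], of squared norm at most [4 a / n]. *)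
Lemma rejection_prob dT (T : measurableType dT) (P : probability T R)
    (eps : nat -> T -> R) (alpha a : R) (f : 'cV[R]_n) :
  iid_std_normal P eps ->
  a = dot (D *m f) (D *m f) / n%:R -> 0 < a ->
  normal_quantile (1 - alpha / 2) * sigma_stat K lam x S <= a / 2 ->
  ((1 - 16 * (4 * a / n%:R + quad_const R * (\tr D / n%:R ^+ 2)) / a ^+ 2)%:E
     <= P [set w | rejects K lam alpha x S (f + noise eps n w)])%E.
Proof.
move=> heps aE a0 hz.
have symD : D^T = D by exact: ridge_smoother_sym.
set v := (2 / n%:R) *: (D *m (D *m f)).
set A := n%:R^-1 *: (D *m D).
have symA : A^T = A by rewrite /A linearZ /= trmx_mul symD.
have := @noise_form_tail _ _ _ P _ heps n v A a _
  (fun w => T_stat K lam x S (f + noise eps n w) - mu_stat K lam x S) symA a0 hz.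
have form w : T_stat K lam x S (f + noise eps n w) - mu_stat K lam x S =
    a + dot v (noise eps n w)
    + (dot (noise eps n w) (A *m noise eps n w) - \tr A).
  by rewrite T_stat_decomposition -aE.
move=> /(_ form); apply: le_trans; rewrite lee_fin lerD2l lerN2.
rewrite ler_wpM2r ?invr_ge0 ?exprn_ge0 ?(ltW a0)// ler_wpM2l//; apply: lerD.
  rewrite /v dotZl dotZr mulrA.
  have -> : 2 / n%:R * (2 / n%:R) = 4 / n%:R / n%:R :> R by field.
  have h := ridge_smoother_norm S symK psdK lam_gt0 (D *m f).
  apply: (@le_trans _ _ (4 / n%:R / n%:R * dot (D *m f) (D *m f))).
    by rewrite ler_wpM2l// !mulr_ge0 ?invr_ge0.
  by rewrite aE le_eqVlt; apply/orP; left; apply/eqP; field.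
rewrite ler_wpM2l ?quad_const_ge0//.
have -> : \tr (A *m A) = \tr (D ^+ 4) / n%:R ^+ 2.
  rewrite /A -scalemxAl -scalemxAr !mxtraceZ.
  have -> : D ^+ 4 = D *m D *m (D *m D) by rewrite !mulmxE -!expr2 -exprM.
  by field.
rewrite ler_wpM2r ?invr_ge0 ?exprn_ge0//; exact: tr_ridge_smoother4.
Qed.

End Statistic.

Section Rates.
Variables (R : realType) (m : R) (n : nat).
Hypotheses (m_gt0 : 0 < m) (n_gt0 : (0 < n)%N).

Let nR_gt0 : 0 < n%:R :> R. Proof. by rewrite ltr0n. Qed.
Let m41 : 4 * m + 1 != 0.
Proof. by rewrite gt_eqF// addr_gt0// mulr_gt0. Qed.

Lemma lambda_star_gt0 : 0 < lambda_star m n.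
Proof. exact: powR_gt0. Qed.

Lemma separation_rate_sqr :
  (n%:R `^ (- (2 * m / (4 * m + 1)))) ^+ 2 = lambda_star m n.
Proof.
rewrite -powR_mulrn ?powR_ge0// -powRrM; congr (_ `^ _).
by field.
Qed.

Lemma lambda_star_sqr :
  n%:R `^ (2 / (4 * m + 1)) / n%:R ^+ 2 = lambda_star m n ^+ 2.
Proof.
have -> : n%:R ^+ 2 = n%:R `^ 2 :> R by rewrite powR_mulrn.
rewrite -powRB; last first.
  by rewrite (gt_eqF nR_gt0) implybT.
rewrite -[RHS]powR_mulrn ?powR_ge0// /lambda_star -powRrM; congr (_ `^ _).
by field.
Qed.

Lemma lambda_star_ge : 1 <= n%:R * lambda_star m n.
Proof.
rewrite -{1}[n%:R]powRr1 ?ler0n// /lambda_star -powRD; last first.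
  by rewrite (gt_eqF nR_gt0) implybT.
apply: (@le_trans _ _ (n%:R `^ 0)); first by rewrite powRr0.
apply: ler_powR; first by rewrite ler1n.
have -> : 1 - (4 * m / (4 * m + 1)) = (4 * m + 1)^-1 by field.
by rewrite invr_ge0 addr_ge0// mulr_ge0// ltW.
Qed.

(** Relative to [a^2], the variance of the linear form is of the order of [1 / (n a)],
    at most [1 / q] because [n lambda_star >= 1]; that of the quadratic form is of the
    order of [n^(2 / (4 m + 1)) / (n a)^2 = (lambda_star / a)^2], at most [1 / q^2]. *)
Lemma type_two_error_le (a q tr kappa C1 e : R) :
  0 < e -> 1 <= q -> 0 <= kappa -> 0 <= C1 ->
  (64 + 16 * (kappa * C1)) / e <= q ->
  q * lambda_star m n <= a ->
  tr <= C1 * n%:R `^ (2 / (4 * m + 1)) ->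
  16 * (4 * a / n%:R + kappa * (tr / n%:R ^+ 2)) / a ^+ 2 <= e.
Proof.
move=> e0 q1 k0 C10 Wq qa trC.
have r0 := lambda_star_gt0; have nr := lambda_star_ge.
set r := lambda_star m n in r0 nr qa *.
have q0 : 0 < q by exact: lt_le_trans ltr01 q1.
have a0 : 0 < a by apply: lt_le_trans qa; rewrite mulr_gt0.
have h1 : 4 * a / n%:R / a ^+ 2 <= 4 / q.
  have -> : 4 * a / n%:R / a ^+ 2 = 4 / (n%:R * a).
    by field; rewrite !gt_eqF.
  rewrite ler_pM2l// lef_pV2 ?posrE ?mulr_gt0//.
  apply: (@le_trans _ _ (q * (n%:R * r))); first by rewrite ler_peMr// ltW.
  by rewrite mulrCA ler_pM2l.
have h2 : tr / n%:R ^+ 2 / a ^+ 2 <= C1 / q.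
  have trr : tr / n%:R ^+ 2 <= C1 * r ^+ 2.
    by rewrite /r -lambda_star_sqr mulrA ler_pM2r// invr_gt0 exprn_gt0.
  rewrite ler_pdivrMr ?exprn_gt0//; apply: le_trans trr _.
  apply: (@le_trans _ _ (C1 / q * (q * r) ^+ 2)).
    have -> : C1 / q * (q * r) ^+ 2 = q * (C1 * r ^+ 2).
      by field; rewrite gt_eqF.
    by rewrite ler_peMl// mulr_ge0// sqr_ge0.
  apply: ler_wpM2l; first by rewrite divr_ge0// ltW.
  by rewrite lerXn2r// nnegrE ltW// mulr_gt0.
have h3 : kappa * (tr / n%:R ^+ 2 / a ^+ 2) <= kappa * (C1 / q).
  by apply: ler_wpM2l.
have -> : 16 * (4 * a / n%:R + kappa * (tr / n%:R ^+ 2)) / a ^+ 2 =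
    16 * (4 * a / n%:R / a ^+ 2) + 16 * (kappa * (tr / n%:R ^+ 2 / a ^+ 2)).
  by field; rewrite !gt_eqF.
apply: (@le_trans _ _ ((64 + 16 * (kappa * C1)) / q)).
  have -> : (64 + 16 * (kappa * C1)) / q = 16 * (4 / q) + 16 * (kappa * (C1 / q)).
    by field; rewrite gt_eqF.
  by apply: lerD; rewrite ler_pM2l.
by move: Wq; rewrite !ler_pdivrMr// (mulrC e).
Qed.

End Rates.

Lemma measurable_sample (R : realType) (d : nat) (dO : measure_display)
    (Omega : measurableType dO) (x : nat -> Omega -> d.-tuple R) n :
  (forall i, measurable_fun setT (x i)) ->
  measurable_fun setT (sample x n).
Proof.
move=> mx; apply/measurable_fun_tnthP => i.
rewrite (_ : _ \o _ = x i)//; apply/funext => w /=.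
by rewrite /sample tnth_mktuple.
Qed.

(** [|f|^2 <= 2 |D f|^2 + 2 |f - D f|^2], and the residual is at most the ridge
    criterion at the approximant of [satisfiable_approx]. *)
Lemma satisfiable_signal (R : realType) (d n s : nat) (X : set (d.-tuple R))
    (H : set (d.-tuple R -> R))
    (ip : (d.-tuple R -> R) -> (d.-tuple R -> R) -> R)
    (K : d.-tuple R -> d.-tuple R -> R) (c lam C : R)
    (x : n.-tuple (d.-tuple R)) (S : 'M[R]_(s, n)) (f : d.-tuple R -> R) :
  (0 < n)%N -> 0 < lam -> rkhs X H ip K -> (forall i, X (tnth x i)) ->
  satisfiable c lam (gram K x) S ->
  H f -> Num.sqrt (ip f f) <= C ->
  forall fv D, fv = \col_i f (tnth x i) ->
  D = ridge_smoother (gram K x) S lam ->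
  emp_norm x f ^+ 2 / 2 - (3 + 9 * c ^+ 2) * C ^+ 2 * lam
    <= dot (D *m fv) (D *m fv) / n%:R.
Proof.
move=> n0 lam0 hH Xx sat Hf fC fv D fvE DE.
have n_gt0 : 0 < n%:R :> R by rewrite ltr0n.
have ip0 := rkhs_ip_ge0 hH Hf.
have ipC : ip f f <= C ^+ 2.
  by rewrite -(sqr_sqrtr ip0) lerXn2r ?nnegrE ?sqrtr_ge0// (le_trans _ fC) ?sqrtr_ge0.
have [symK psdK] := satisfiable_sym_psd sat.
have fvB a : dot a fv ^+ 2 <= (C ^+ 2 * n%:R) * dot a (gram K x *m a).
  rewrite fvE; apply: le_trans (rkhs_sample_le hH n0 Xx Hf a) _.
  by apply: ler_wpM2r; [exact: psdK|apply: ler_wpM2r].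
have B0 : 0 <= C ^+ 2 * n%:R by rewrite mulr_ge0// sqr_ge0.
have [b hb] := satisfiable_approx lam0 B0 sat fvB.
have h1 := le_trans (ridge_smoother_residual S symK psdK lam0 fv b) hb.
rewrite -DE in h1.
have h2 := dotvvD (D *m fv) (fv - D *m fv).
rewrite addrC subrK in h2.
have e1 : emp_norm x f ^+ 2 = dot fv fv / n%:R.
  rewrite /emp_norm sqr_sqrtr; last first.
    by rewrite mulr_ge0 ?invr_ge0// sumr_ge0// => i _; rewrite sqr_ge0.
  rewrite mulrC dotE; congr (_ / _); apply: eq_bigr => i _.
  by rewrite fvE !mxE expr2.
rewrite e1 ler_pdivlMr// mulrBl.
have -> : dot fv fv / n%:R / 2 * n%:R = dot fv fv / 2.
  by field; rewrite gt_eqF.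
move: h1 h2; move: (dot fv fv) (dot (D *m fv) _) (dot (fv - _) _) => p q r.
move=> h1 h2; nra.
Qed.

Theorem corollary4p9 (R : realType) (m : R) (hm : 3 / 2 < m) :
  exists2 cm : R, 0 < cm &
  forall (d : nat) (hd : (0 < d)%N)
    (X : set (d.-tuple R)) (hX : measurable X)
    (PX : probability (d.-tuple R) R) (hPX : PX X = 1%E)
    (H : set (d.-tuple R -> R))
    (ip : (d.-tuple R -> R) -> (d.-tuple R -> R) -> R)
    (K : d.-tuple R -> d.-tuple R -> R)
    (mu : nat -> R) (phi : nat -> d.-tuple R -> R)
    (hH : rkhs X H ip K)
    (hHL2 : forall f, H f -> f \in Lfun PX 2%:E)
    (hK : eigen_system X PX H ip K mu phi)
    (hA1 : assumption_A1 X mu phi)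
    (hmu : (mu : nat -> R^o) \is
       'Theta_\oo (fun i : nat => i.+1%:R `^ (- (2 * m)) : R^o)),
  ((fun n : nat => (s_lambda mu (lambda_star m n))%:R : R^o) \is
     'Theta_\oo (fun n : nat => n%:R `^ (2 / (4 * m + 1)) : R^o)) /\
  exists2 dconst : R, 0 < dconst &
  forall (dO : measure_display) (Omega : measurableType dO)
    (P : probability Omega R)
    (x : nat -> Omega -> d.-tuple R) (hx : iid_design P x X PX)
    (eps : nat -> Omega -> R) (heps : iid_std_normal P eps)
    (lam : nat -> R) (hlam0 : forall n, 0 < lam n)
    (hlam : (lam : nat -> R^o) \is 'Theta_\oo (lambda_star m : nat -> R^o))
    (s : nat -> nat) (S : forall n : nat, Omega -> 'M[R]_(s n, n))
    (hS : forall n, random_sketch (S n))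
    (hind : forall n, noise_independent P x eps (S n))
    (c1 c2 : \bar R) (hc1 : (0 < c1)%E) (hc2 : (0 < c2)%E)
    (hA2 : assumption_A2 P x K mu lam S dconst c1 c2)
    (alpha : R) (halpha : 0 < alpha < 1) (C : R)
    (e : R) (he : 0 < e),
  exists (Ce : R) (Ne : nat),
  forall n : nat, (0 < n)%N -> (Ne <= n)%N ->
  exists A : set Omega,
  [/\ measurable A,
      A `<=` [set w | ((1 - e)%:E <= ereal_inf
        [set cond_power P x eps K (lam n) alpha (S n) f w | f in
           separated_ball H ip C (Ce * n%:R `^ (- (2 * m / (4 * m + 1))))
             (sample x n w)])%E] &
      (1 - (expR (- (cm * n%:R `^ ((2 * m - 3) / (2 * m - 1)))))%:E
         - expeR (- (c1 * (s n)%:R%:E))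
         - expeR (- (c2 * (minn (s_lambda mu (lam n))
                                (s_lambda mu (lambda_star m n)))%:R%:E))
       < P A)%E].
Proof.
exists 1; first exact: ltr01.
move=> d hd X mX PX hPX H ip K mu phi hH _ hK [[M hM] [M' hM']] hmu.
have m0 : 0 < m by apply: lt_trans hm; rewrite divr_gt0.
have mu_ge0 := eigen_ge0 hK; have mu_ni := eigen_noninc hK.
split; first exact: s_lambda_star_theta.
exists 1 => // dO Omega P x hx eps heps lam lam0 hlam s S _ _ c1 c2 c10 c20.
move=> [_ [c c0 hab]] alpha halpha C e he.
have [C1 [N1 [C10 hC1]]] :=
  tail_asymptotics m0 mu_ge0 hmu M lam0 hlam hM'.
have [l1 [l2 [N2 [_ l20 hl2]]]] := (theta_nneg (fun k => ltW (lam0 k))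
  (fun k => powR_ge0 k%:R (- (4 * m / (4 * m + 1))))).1 hlam.
pose z := normal_quantile (1 - alpha / 2) : R.
pose B := (3 + 9 * c ^+ 2) * C ^+ 2.
have B0 : 0 <= B.
  by rewrite mulr_ge0 ?sqr_ge0// addr_ge0// mulr_ge0// sqr_ge0.
pose W := 64 + 16 * (quad_const R * C1).
have W0 : 0 <= W.
  by rewrite addr_ge0// mulr_ge0// mulr_ge0 ?quad_const_ge0// ltW.
(* The shift of the statistic will be at least [q] times [lambda_star].  The terms of
   [q] absorb the bias, the critical value and the error probability; the factor [2]
   in the separation constant makes up for halving the squared norm. *)
pose q := 1 + B * l2 + 2 * (`|z| * Num.sqrt (2 * C1)) + W / e.
have terms_le (u v w : R) : 0 <= u -> 0 <= v -> 0 <= w ->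
    [/\ 1 <= 1 + u + v + w, u <= 1 + u + v + w, v <= 1 + u + v + w
      & w <= 1 + u + v + w] by clear; move=> u0 v0 w0; split; lra.
have [q1 qB qz qW] : [/\ 1 <= q, B * l2 <= q,
    2 * (`|z| * Num.sqrt (2 * C1)) <= q & W / e <= q].
  apply: terms_le; first by rewrite mulr_ge0// ltW.
    by rewrite !mulr_ge0// sqrtr_ge0.
  by rewrite divr_ge0// ltW.
have q0 : 0 < q by exact: lt_le_trans ltr01 q1.
clear terms_le; clearbody q.
exists (2 * Num.sqrt q), (maxn N1 N2) => n n0.
rewrite geq_max => /andP[nN1 nN2].
have n_gt0 : 0 < n%:R :> R by rewrite ltr0n.
have [mx Xx lawx indx] := hx.
have habn := hab n n0; have mE : measurable _ := habn.1.
exists [set w | satisfiable c (lam n) (gram K (sample x n w)) (S n w)].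
split => //.
- move=> w /= sat; apply/ereal_infP => _ [f [Hf fC fr] <-].
  set xs := sample x n w in sat fr *.
  have xsE i : tnth xs i = x i w by rewrite /xs /sample tnth_mktuple.
  have Xxs i : X (tnth xs i) by rewrite xsE.
  have [symK psdK] := satisfiable_sym_psd sat.
  set Sn := S n w in sat *.
  pose D := ridge_smoother (gram K xs) Sn (lam n).
  pose fv : 'cV[R]_n := \col_i f (tnth xs i).
  have sig := satisfiable_signal n0 (lam0 n) hH Xxs sat Hf fC (erefl fv) (erefl D).
  set a := dot _ _ / _ in sig.
  have r_gt0 := lambda_star_gt0 m n0.
  have qa : q * lambda_star m n <= a.
    apply: le_trans sig.
    have emp2 : 4 * (q * lambda_star m n) <= emp_norm xs f ^+ 2.
      have -> : 4 * (q * lambda_star m n) =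
          (2 * Num.sqrt q * n%:R `^ (- (2 * m / (4 * m + 1)))) ^+ 2.
        by rewrite !exprMn separation_rate_sqr// sqr_sqrtr ?(ltW q0)//; ring.
      rewrite lerXn2r// nnegrE; last exact: sqrtr_ge0.
      by rewrite !mulr_ge0 ?sqrtr_ge0 ?powR_ge0.
    have bias : B * lam n <= q * lambda_star m n.
      apply: (@le_trans _ _ (B * (l2 * lambda_star m n))).
        by apply: ler_wpM2l => //; exact: (hl2 n nN2).2.
      by rewrite mulrA; apply: ler_wpM2r => //; exact: ltW.
    rewrite -/B; move: emp2 bias; clear.
    by move: (_ ^+ 2) (B * _) (q * _) => u v t; lra.
  have a0 : 0 < a by apply: lt_le_trans qa; rewrite mulr_gt0.
  have trD : \tr D <= C1 * n%:R `^ (2 / (4 * m + 1)).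
    have [k [T [hT hkT]]] := hC1 n nN1.
    apply: le_trans hkT; apply: le_trans (tr_ridge_smoother_le _ symK psdK (lam0 n)) _.
    apply: (@effective_dimension_le _ _ X K mu phi mu_ge0) => //.
      by move=> y y' Xy Xy'; exact: (eigen_expansion hK).
  have sigma_le : sigma_stat K (lam n) xs Sn <= Num.sqrt (2 * C1) * lambda_star m n.
    apply: le_trans; first exact: sigma_stat_le.
    have <- : Num.sqrt (2 * C1 * lambda_star m n ^+ 2) =
        Num.sqrt (2 * C1) * lambda_star m n.
      by rewrite sqrtrM ?sqrtr_sqr ?ger0_norm ?(ltW r_gt0)// mulr_ge0// ltW.
    rewrite ler_wsqrtr// -lambda_star_sqr// mulrA ler_wpM2r ?invr_ge0 ?exprn_ge0//.
    by rewrite -mulrA ler_wpM2l.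
  have crit : z * sigma_stat K (lam n) xs Sn <= a / 2.
    have sigma0 : 0 <= sigma_stat K (lam n) xs Sn by exact: sqrtr_ge0.
    apply: (@le_trans _ _ (`|z| * (Num.sqrt (2 * C1) * lambda_star m n))).
      apply: (@le_trans _ _ (`|z| * sigma_stat K (lam n) xs Sn)).
        by apply: ler_wpM2r => //; exact: ler_norm.
      exact: ler_wpM2l.
    rewrite ler_pdivlMr// mulrC !mulrA; apply: le_trans qa.
    by apply: ler_wpM2r; [exact: ltW|rewrite -mulrA].
  have := rejection_prob (n := n) n0 (lam0 n) symK psdK (alpha := alpha) (a := a)
    (f := fv) heps erefl a0 crit.
  have -> : [set w' | rejects K (lam n) alpha xs Sn (fv + noise eps n w')] =
     [set w' | rejects K (lam n) alpha xs Sn (\col_i (f (x i w) + eps i w'))].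
    apply/seteqP; split=> w' /=; congr (rejects _ _ _ _ _ _ : Prop);
      by apply/matrixP => i j; rewrite !mxE xsE.
  apply: le_trans; rewrite lee_fin lerD2l lerN2.
  exact: (type_two_error_le m0 n0 he q1 (quad_const_ge0 R) (ltW C10) qW qa trD).
- have s0 k : (0 <= k%:R%:E :> \bar R)%E by rewrite lee_fin.
  have as0 : (0 <= c1 * (s n)%:R%:E)%E by rewrite mule_ge0// ltW.
  have := ab_type_prob (@measurable_sample _ _ _ _ x n mx) as0 habn.
  have Pfin := fin_num_measure P _ mE.
  rewrite -(fineK Pfin); move: (fine _) => p.
  set k1 := s_lambda mu (lam n); set k2 := minn _ _.
  have k21 : (c2 * k2%:R%:E <= c2 * k1%:R%:E)%E.
    by rewrite lee_wpmul2l ?(ltW c20)// lee_fin ler_nat geq_minl.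
  have b0 : (0 <= c2 * k2%:R%:E)%E by rewrite mule_ge0// ltW.
  have fin (t : \bar R) : (0 <= t)%E -> expeR (- t)%E \is a fin_num by case: t.
  have rr : (expeR (- (c2 * k1%:R%:E)) <= expeR (- (c2 * k2%:R%:E)))%E.
    by rewrite ler_expeR leeN2.
  have := rr.
  rewrite -(fineK (fin _ as0)) -(fineK (fin _ b0)).
  rewrite -(fineK (fin _ (le_trans b0 k21))).
  move: (fine _) (fine (expeR (- (c2 * k2%:R%:E)))) (fine _) => u v t.
  rewrite -!EFinB !lee_fin lte_fin => vt h.
  (* The positive exponential term makes the inequality strict. *)
  have := expR_gt0 (- (1 * n%:R `^ ((2 * m - 3) / (2 * m - 1)))).
  move: (expR _) vt h => ex; clear; lra.
Qed.
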